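(* Let $\tau>2$ and $\xi\in\mathcal{D}(\tau)$, let $\beta=e^{2i\pi\xi}$, $\varphi(z)=\beta z$, and consider the operator $C_\varphi$ on $\mathrm{Hol}(\mathbb{D})$ given by $C_\varphi f=f\circ\varphi$. Then $$\{\beta^n:n\in\mathbb{N}_0\}\subset\sigma(C_\varphi)\subset\{e^{2i\pi x}:x\in\mathbb{R}\setminus\mathbb{Q}\}\cup\{1\}.$$
   Context: $\mathbb{D}$ is the open unit disc, $\mathrm{Hol}(\mathbb{D})$ the Fréchet space of holomorphic functions on $\mathbb{D}$ (topology of uniform convergence on compact sets), $\mathbb{N}_0=\mathbb{N}\cup\{0\}$. For a linear operator $S$ on $\mathrm{Hol}(\mathbb{D})$, $\sigma(S)$ is the set of $\lambda\in\mathbb{C}$ such that $\lambda\mathrm{Id}-S$ is not bijective. For $\tau>2$, $\mathcal{D}(\tau)$ is the set of $\xi\in\mathbb{R}$ for which there exists $\gamma>0$ with $|p/q-\xi|\geq\gamma q^{-\tau}$ for all $p\in\mathbb{Z}$, $q\in\mathbb{N}$ (diophantine numbers of order $\tau$). *)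

(* Defs.v *)
From Stdlib Require Import Reals ZArith.
From Coquelicot Require Import Coquelicot.
Open Scope R_scope.

Definition in_disc (z : C) : Prop := Cmod z < 1.

Definition C_differentiable (f : C -> C) (z : C) : Prop :=
  ex_derive (K := C_AbsRing) (V := C_NormedModule) f z.

(* f represents an element of Hol(D): holomorphic at every point of D. *)
Definition holo_disc (f : C -> C) : Prop :=
  forall z : C, in_disc z -> C_differentiable f z.

(* Two representatives define the same element of Hol(D). *)
Definition eq_on_disc (f g : C -> C) : Prop :=
  forall z : C, in_disc z -> f z = g z.

Definition e2ipi (x : R) : C := (cos (2 * PI * x), sin (2 * PI * x)).

Definition comp_rot (beta : C) (f : C -> C) : C -> C :=
  fun z => f (Cmult beta z).

Definition shifted (lam : C) (S : (C -> C) -> (C -> C)) (f : C -> C) : C -> C :=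
  fun z => Cminus (Cmult lam (f z)) (S f z).

(* lambda Id - S is a bijection of Hol(D) onto itself
   (elements of Hol(D) = holomorphic functions on D up to equality on D). *)
Definition bijective_on_Hol (T : (C -> C) -> (C -> C)) : Prop :=
  (forall f1 f2 : C -> C, holo_disc f1 -> holo_disc f2 ->
      eq_on_disc (T f1) (T f2) -> eq_on_disc f1 f2) /\
  (forall g : C -> C, holo_disc g ->
      exists f : C -> C, holo_disc f /\ eq_on_disc (T f) g).

Definition in_spectrum (S : (C -> C) -> (C -> C)) (lam : C) : Prop :=
  ~ bijective_on_Hol (shifted lam S).

Definition diophantine (tau xi : R) : Prop :=
  exists gamma : R, gamma > 0 /\
    forall (p : Z) (q : nat), (0 < q)%nat ->
      Rabs (IZR p / INR q - xi) >= gamma * Rpower (INR q) (- tau).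

Definition irrational (x : R) : Prop :=
  forall (p : Z) (q : nat), (0 < q)%nat -> x <> IZR p / INR q.

(* Main.v *)
(* On the monomial z^n the operator [lambda - C_phi] acts as multiplication by
   lambda - beta^n, so it is not injective when lambda = beta^n. Conversely, if
   |lambda - beta^n| >= c (n+1)^(-m) for all n, dividing the n-th Taylor
   coefficient by lambda - beta^n keeps the radius of convergence at least 1, and
   [lambda - C_phi] is bijective. Such a bound is trivial when |lambda| <> 1; when
   lambda = e^(2 i pi p/q) <> 1 it is the diophantine condition applied to
   fractions with denominator n q, because |lambda - beta^n| dominates the
   distance from n xi - p/q to the integers.

   Holomorphy being mere pointwise differentiability, Taylor's expansion rests on
   Goursat's lemma, used in logarithmic coordinates, where it says that the mean
   of g over |w| = r does not depend on r. *)
Require Import Defs.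
From Stdlib Require Import Reals ZArith Lra Lia.
From Coquelicot Require Import Coquelicot.
Open Scope R_scope.

(** * Goursat's lemma on rectangles *)

(** The obstacle is that the function whose means are needed contains a difference quotient of f at
    the point z of the expansion, completed at z by the derivative. Before Taylor's expansion is
    available, such a quotient is only known to be continuous at z. Means over two circles are
    compared through the whole annulus between them, so this one bad point spoils the entire circle
    |w| = |z|: Goursat's lemma makes the mean constant on each side of it, and only continuity of
    the mean in the radius joins the two sides. The same continuity reaches the radius 0, which
    logarithmic coordinates never attain.

    The coefficients obtained from a circle depend a priori on its radius; uniqueness of power
    series coefficients identifies them.

    On the arithmetic side any polynomial bound will do, so the real exponent [tau] is rounded up to
    a natural number. *)

Lemma continuity_2d_continuous_fst (f : R -> R -> R) (x y : R) :
  continuity_2d_pt f x y -> continuous (fun u => f u y) x.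
Proof.
  intros H; apply continuity_pt_filterlim.
  apply continuity_pt_locally; intros eps.
  destruct (H eps) as [d Hd]; exists d; intros u Hu.
  apply Hd; [exact Hu | rewrite Rminus_diag, Rabs_R0; apply cond_pos].
Qed.

Lemma continuity_2d_continuous_snd (f : R -> R -> R) (x y : R) :
  continuity_2d_pt f x y -> continuous (fun v => f x v) y.
Proof.
  intros H; apply continuity_pt_filterlim.
  apply continuity_pt_locally; intros eps.
  destruct (H eps) as [d Hd]; exists d; intros v Hv.
  apply Hd; [rewrite Rminus_diag, Rabs_R0; apply cond_pos | exact Hv].
Qed.

Lemma differentiable_pt_lim_continuity_2d (f : R -> R -> R) (x y lx ly : R) :
  differentiable_pt_lim f x y lx ly -> continuity_2d_pt f x y.
Proof. intros H; apply differentiable_continuity_pt; now exists lx, ly. Qed.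

(** Closedness of the form P dx + Q dy at one point: the shared [q] is both the y-derivative of [P]
    and the x-derivative of [Q]. Nothing is asked of the continuity of the partial derivatives, so
    Green's formula cannot replace the bisection below. *)
Definition closed_form_pt (P Q : R -> R -> R) (x y : R) : Prop :=
  exists px q qy : R,
    differentiable_pt_lim P x y px q /\ differentiable_pt_lim Q x y q qy.

(** The integral of P dx + Q dy along the boundary of [a, b] x [c, d], counterclockwise, with
    opposite sides grouped because their leading terms are compared in pairs. *)
Definition rect_int (P Q : R -> R -> R) (a b c d : R) : R :=
  (RInt (fun x => P x c) a b - RInt (fun x => P x d) a b) +
  (RInt (fun y => Q b y) c d - RInt (fun y => Q a y) c d).

Lemma ex_RInt_horizontal (P Q : R -> R -> R) (a0 b0 c0 d0 : R) :
  (forall x y, a0 <= x <= b0 -> c0 <= y <= d0 -> closed_form_pt P Q x y) ->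
  forall a b y : R,
  a0 <= a <= b0 -> a0 <= b <= b0 -> c0 <= y <= d0 -> ex_RInt (fun x => P x y) a b.
Proof.
  intros HPQ a b y Ha Hb Hy; apply (ex_RInt_continuous (V := R_CompleteNormedModule)); intros z Hz.
  apply (continuity_2d_continuous_fst P).
  destruct (HPQ z y) as (px & q & qy & H1 & H2); [|exact Hy|].
  - unfold Rmin, Rmax in Hz; destruct (Rle_dec a b); lra.
  - exact (differentiable_pt_lim_continuity_2d _ _ _ _ _ H1).
Qed.

Lemma ex_RInt_vertical (P Q : R -> R -> R) (a0 b0 c0 d0 : R) :
  (forall x y, a0 <= x <= b0 -> c0 <= y <= d0 -> closed_form_pt P Q x y) ->
  forall c d x : R,
  a0 <= x <= b0 -> c0 <= c <= d0 -> c0 <= d <= d0 -> ex_RInt (fun y => Q x y) c d.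
Proof.
  intros HPQ c d x Hx Hc Hd; apply (ex_RInt_continuous (V := R_CompleteNormedModule)); intros z Hz.
  apply (continuity_2d_continuous_snd Q).
  destruct (HPQ x z) as (px & q & qy & H1 & H2); [exact Hx| |].
  - unfold Rmin, Rmax in Hz; destruct (Rle_dec c d); lra.
  - exact (differentiable_pt_lim_continuity_2d _ _ _ _ _ H2).
Qed.

(** Each inner side belongs to two of the four rectangles, which traverse it in opposite
    directions. *)
Lemma rect_int_split (P Q : R -> R -> R) (a0 b0 c0 d0 : R) :
  (forall x y, a0 <= x <= b0 -> c0 <= y <= d0 -> closed_form_pt P Q x y) ->
  forall a m b c n d : R,
  a0 <= a -> a <= m -> m <= b -> b <= b0 -> c0 <= c -> c <= n -> n <= d -> d <= d0 ->
  rect_int P Q a b c d =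
  rect_int P Q a m c n + rect_int P Q m b c n +
  rect_int P Q a m n d + rect_int P Q m b n d.
Proof.
  intros HPQ a m b c n d; intros; unfold rect_int.
  assert (HP : forall y, c0 <= y <= d0 -> RInt (fun x => P x y) a b =
            RInt (fun x => P x y) a m + RInt (fun x => P x y) m b).
  { intros y Hy; symmetry; apply (RInt_Chasles (V := R_CompleteNormedModule));
      apply (ex_RInt_horizontal P Q a0 b0 c0 d0 HPQ); lra. }
  assert (HQ : forall x, a0 <= x <= b0 -> RInt (fun y => Q x y) c d =
            RInt (fun y => Q x y) c n + RInt (fun y => Q x y) n d).
  { intros x Hx; symmetry; apply (RInt_Chasles (V := R_CompleteNormedModule));
      apply (ex_RInt_vertical P Q a0 b0 c0 d0 HPQ); lra. }
  rewrite (HP c), (HP d), (HQ a), (HQ b) by lra; lra.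
Qed.

Lemma RInt_minus_const_bound (f g : R -> R) (a b k M : R) :
  a <= b -> ex_RInt f a b -> ex_RInt g a b ->
  (forall x, a <= x <= b -> Rabs (f x - g x - k) <= M) ->
  Rabs (RInt f a b - RInt g a b - k * (b - a)) <= (b - a) * M.
Proof.
  intros Hab Hf Hg HM.
  assert (E : is_RInt (fun x => f x - g x - k) a b
                (RInt f a b - RInt g a b - k * (b - a))).
  { replace (k * (b - a)) with (scal (b - a) k) by (unfold scal; simpl; unfold mult; simpl; ring).
    apply (is_RInt_minus (V := R_NormedModule)); [apply (is_RInt_minus (V := R_NormedModule))|].
    - now apply (RInt_correct (V := R_CompleteNormedModule)).
    - now apply (RInt_correct (V := R_CompleteNormedModule)).
    - apply (is_RInt_const (V := R_NormedModule)). }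
  rewrite <- (is_RInt_unique _ _ _ _ E).
  apply abs_RInt_le_const; [exact Hab | eexists; exact E | exact HM].
Qed.

(** The affine part of the form contributes q (c - d) (b - a) on the horizontal sides and q (b - a)
    (d - c) on the vertical ones; these cancel because [q] is shared. What is left is a remainder of
    order eps times the size, integrated over sides of at most that size. *)
Lemma rect_int_local (P Q : R -> R -> R) (a0 b0 c0 d0 : R) :
  (forall x y, a0 <= x <= b0 -> c0 <= y <= d0 -> closed_form_pt P Q x y) ->
  forall x0 y0 eps : R,
  a0 <= x0 <= b0 -> c0 <= y0 <= d0 -> 0 < eps ->
  exists delta, 0 < delta /\
  forall a b c d,
    a0 <= a <= x0 -> x0 <= b <= b0 -> c0 <= c <= y0 -> y0 <= d <= d0 ->
    (b - a) + (d - c) < delta ->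
    Rabs (rect_int P Q a b c d) <= eps * ((b - a) + (d - c)) ^ 2.
Proof.
  intros HPQ x0 y0 eps Hx0 Hy0 Heps.
  destruct (HPQ x0 y0 Hx0 Hy0) as (px & q & qy & H1 & H2).
  (* Two opposite sides each carry a remainder, hence the half. *)
  assert (He : 0 < eps / 2) by lra.
  destruct (H1 (mkposreal _ He)) as [e1 E1].
  destruct (H2 (mkposreal _ He)) as [e2 E2].
  simpl in E1, E2.
  exists (Rmin e1 e2); split; [apply Rmin_case; apply cond_pos|].
  intros a b c d Ha Hb Hc Hd HL.
  set (L := (b - a) + (d - c)) in *.
  pose proof (Rmin_l e1 e2); pose proof (Rmin_r e1 e2).
  assert (near : forall u, a <= u <= b -> Rabs (u - x0) <= L)
    by (intros u Hu; apply Rabs_le; unfold L; lra).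
  assert (near' : forall v, c <= v <= d -> Rabs (v - y0) <= L)
    by (intros v Hv; apply Rabs_le; unfold L; lra).
  assert (F1 : forall u v, a <= u <= b -> c <= v <= d ->
     Rabs (P u v - P x0 y0 - (px * (u - x0) + q * (v - y0))) <= eps / 2 * L).
  { intros u v Hu Hv; specialize (near u Hu); specialize (near' v Hv).
    eapply Rle_trans; [apply E1; lra|].
    apply Rmult_le_compat_l; [lra | apply Rmax_lub; lra]. }
  assert (F2 : forall u v, a <= u <= b -> c <= v <= d ->
     Rabs (Q u v - Q x0 y0 - (q * (u - x0) + qy * (v - y0))) <= eps / 2 * L).
  { intros u v Hu Hv; specialize (near u Hu); specialize (near' v Hv).
    eapply Rle_trans; [apply E2; lra|].
    apply Rmult_le_compat_l; [lra | apply Rmax_lub; lra]. }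
  assert (G1 : Rabs (RInt (fun x => P x c) a b - RInt (fun x => P x d) a b
                     - (q * (c - d)) * (b - a)) <= (b - a) * (eps * L)).
  { apply RInt_minus_const_bound; try lra; try (apply (ex_RInt_horizontal P Q a0 b0 c0 d0 HPQ); lra).
    intros x Hx.
    assert (A1 := F1 x c Hx ltac:(lra)); assert (A2 := F1 x d Hx ltac:(lra)).
    apply Rabs_le_between in A1; apply Rabs_le_between in A2; apply Rabs_le; lra. }
  assert (G2 : Rabs (RInt (fun y => Q b y) c d - RInt (fun y => Q a y) c d
                     - (q * (b - a)) * (d - c)) <= (d - c) * (eps * L)).
  { apply RInt_minus_const_bound; try lra; try (apply (ex_RInt_vertical P Q a0 b0 c0 d0 HPQ); lra).
    intros y Hy.
    assert (A1 := F2 b y ltac:(lra) Hy); assert (A2 := F2 a y ltac:(lra) Hy).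
    apply Rabs_le_between in A1; apply Rabs_le_between in A2; apply Rabs_le; lra. }
  unfold rect_int.
  apply Rabs_le_between in G1; apply Rabs_le_between in G2; apply Rabs_le.
  replace (eps * L ^ 2) with ((b - a) * (eps * L) + (d - c) * (eps * L))
    by (unfold L; ring).
  lra.
Qed.

(** The supremum of the left endpoints lies in every interval [a n, a n + l / 2^n]. *)
Lemma nested_dyadic (a : nat -> R) (l : R) :
  (forall n, a n <= a (S n) /\ a (S n) + l / 2 ^ S n <= a n + l / 2 ^ n) ->
  0 <= l ->
  exists x, forall n, a n <= x <= a n + l / 2 ^ n.
Proof.
  intros H Hl.
  assert (pos : forall n, 0 <= l / 2 ^ n).
  { intros n; apply Rle_mult_inv_pos; [exact Hl | apply pow_lt; lra]. }
  assert (up : forall n k, a n <= a (n + k)%nat).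
  { intros n k; induction k as [|k IH]; [rewrite Nat.add_0_r; lra|].
    rewrite Nat.add_succ_r; destruct (H (n + k)%nat); lra. }
  assert (dn : forall n k, a (n + k)%nat + l / 2 ^ (n + k) <= a n + l / 2 ^ n).
  { intros n k; induction k as [|k IH]; [rewrite Nat.add_0_r; lra|].
    rewrite Nat.add_succ_r; destruct (H (n + k)%nat); lra. }
  assert (bnd : forall n m, a m <= a n + l / 2 ^ n).
  { intros n m; destruct (Nat.le_ge_cases n m) as [h|h].
    - replace m with (n + (m - n))%nat by lia.
      specialize (dn n (m - n)%nat); specialize (pos (n + (m - n))%nat); lra.
    - replace n with (m + (n - m))%nat by lia.
      specialize (up m (n - m)%nat); specialize (pos (m + (n - m))%nat); lra. }
  destruct (completeness (fun y => exists n, y = a n)) as [x [Hub Hlub]].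
  - exists (a 0%nat + l / 2 ^ 0); intros y [n ->]; apply bnd.
  - exists (a 0%nat), 0%nat; reflexivity.
  - exists x; intros n; split.
    + apply Hub; now exists n.
    + apply Hlub; intros y [m ->]; apply bnd.
Qed.

(** Repeated bisection keeps a cell whose integral is at least J0 / 4^n in absolute value, while
    [rect_int_local] at the common point of the cells bounds it by eps L^2 / 4^n; a small [eps]
    makes these incompatible. *)
Lemma goursat_rect (P Q : R -> R -> R) (a b c d : R) :
  a <= b -> c <= d ->
  (forall x y, a <= x <= b -> c <= y <= d -> closed_form_pt P Q x y) ->
  rect_int P Q a b c d = 0.
Proof.
  intros Hab Hcd HPQ.
  destruct (Req_dec (rect_int P Q a b c d) 0) as [E|NE]; [exact E|exfalso].
  set (lx := b - a); set (ly := d - c).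
  set (J := fun (n : nat) (p : R * R) =>
    Rabs (rect_int P Q (fst p) (fst p + lx / 2 ^ n) (snd p) (snd p + ly / 2 ^ n))).
  set (J0 := J 0%nat (a, c)).
  (* A cell is stored by its lower left corner, its sides being determined by [n]. Three quarters
     are tested and the fourth is taken by default; [quarter] shows that the default is sound, since
     four integrals below a quarter of the total could not add up to it. *)
  set (step := fun (n : nat) (p : R * R) =>
    let x' := fst p + lx / 2 ^ S n in
    let y' := snd p + ly / 2 ^ S n in
    if Rle_dec (J n p / 4) (J (S n) p) then p else
    if Rle_dec (J n p / 4) (J (S n) (x', snd p)) then (x', snd p) else
    if Rle_dec (J n p / 4) (J (S n) (fst p, y')) then (fst p, y') else (x', y')).
  set (p := fix p n := match n with O => (a, c) | S n => step n (p n) end).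
  assert (half : forall l n, l / 2 ^ n = l / 2 ^ S n + l / 2 ^ S n).
  { intros l n; simpl; field; apply pow_nonzero; lra. }
  assert (pos : forall l n, 0 <= l -> 0 <= l / 2 ^ n).
  { intros l n Hl; apply Rle_mult_inv_pos; [exact Hl | apply pow_lt; lra]. }
  assert (Hlx : 0 <= lx) by (unfold lx; lra).
  assert (Hly : 0 <= ly) by (unfold ly; lra).
  assert (cell : forall n q,
    (fst (step n q) = fst q \/ fst (step n q) = fst q + lx / 2 ^ S n) /\
    (snd (step n q) = snd q \/ snd (step n q) = snd q + ly / 2 ^ S n)).
  { intros n q; unfold step; repeat destruct Rle_dec; simpl; tauto. }
  assert (inv : forall n, a <= fst (p n) /\ fst (p n) + lx / 2 ^ n <= b /\
                          c <= snd (p n) /\ snd (p n) + ly / 2 ^ n <= d).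
  { induction n as [|n IH]; [simpl; unfold lx, ly; lra|].
    change (p (S n)) with (step n (p n)).
    pose proof (half lx n); pose proof (half ly n).
    pose proof (pos lx (S n) Hlx); pose proof (pos ly (S n) Hly).
    destruct (cell n (p n)) as [[-> | ->] [-> | ->]]; lra. }
  assert (quarter : forall n, J n (p n) / 4 <= J (S n) (p (S n))).
  { intros n; change (p (S n)) with (step n (p n)).
    unfold step; repeat (destruct Rle_dec as [h|?]; [exact h|]).
    apply Rnot_le_lt in n0, n1, n2.
    destruct (inv n) as (I1 & I2 & I3 & I4).
    pose proof (half lx n) as hx; pose proof (half ly n) as hy.
    pose proof (pos lx (S n) Hlx); pose proof (pos ly (S n) Hly).
    assert (Sp := rect_int_split P Q a b c d HPQ
       (fst (p n)) (fst (p n) + lx / 2 ^ S n) (fst (p n) + lx / 2 ^ n)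
       (snd (p n)) (snd (p n) + ly / 2 ^ S n) (snd (p n) + ly / 2 ^ n)
       ltac:(lra) ltac:(lra) ltac:(lra) ltac:(lra)
       ltac:(lra) ltac:(lra) ltac:(lra) ltac:(lra)).
    unfold J in *; cbn [fst snd] in *.
    rewrite hx, hy, <- !Rplus_assoc in Sp.
    rewrite hx, hy, <- !Rplus_assoc in n0, n1, n2.
    rewrite hx, hy, <- !Rplus_assoc.
    match type of Sp with ?X = ?A + ?B + ?C + ?D =>
      assert (T : Rabs X <= Rabs A + Rabs B + Rabs C + Rabs D) end.
    { rewrite Sp; eapply Rle_trans; [apply Rabs_triang|].
      apply Rplus_le_compat_r; eapply Rle_trans; [apply Rabs_triang|].
      apply Rplus_le_compat_r; apply Rabs_triang. }
    lra. }
  assert (lower : forall n, J0 / 4 ^ n <= J n (p n)).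
  { induction n as [|n IH]; [simpl; unfold J0; lra|].
    eapply Rle_trans; [|apply quarter].
    replace (J0 / 4 ^ S n) with (J0 / 4 ^ n / 4)
      by (simpl; field; apply pow_nonzero; lra).
    lra. }
  destruct (nested_dyadic (fun n => fst (p n)) lx) as [x0 Hx]; [|exact Hlx|].
  { intros n; simpl p; pose proof (half lx n); pose proof (pos lx (S n) Hlx).
    destruct (cell n (p n)) as [[-> | ->] _]; lra. }
  destruct (nested_dyadic (fun n => snd (p n)) ly) as [y0 Hy]; [|exact Hly|].
  { intros n; simpl p; pose proof (half ly n); pose proof (pos ly (S n) Hly).
    destruct (cell n (p n)) as [_ [-> | ->]]; lra. }
  assert (HJ0 : 0 < J0).
  { unfold J0, J; simpl.
    replace (a + lx / 1) with b by (unfold lx; field).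
    replace (c + ly / 1) with d by (unfold ly; field).
    now apply Rabs_pos_lt. }
  set (L := lx + ly).
  assert (HL : 0 <= L) by (unfold L; lra).
  (* Chosen so that eps L^2 < J0; the added 1 covers a degenerate rectangle with L = 0. *)
  set (eps := J0 / (2 * (L ^ 2 + 1))).
  assert (Hden : 0 < L ^ 2 + 1) by (pose proof (pow2_ge_0 L); lra).
  assert (Heps : 0 < eps) by (unfold eps; apply Rdiv_lt_0_compat; lra).
  assert (Hx0 := Hx 0%nat); assert (Hy0 := Hy 0%nat).
  destruct (inv 0%nat) as (i1 & i2 & i3 & i4).
  destruct (rect_int_local P Q a b c d HPQ x0 y0 eps) as (delta & Hd & Hloc);
    [lra | lra | exact Heps |].
  destruct (pow_lt_1_zero (/ 2) ltac:(rewrite Rabs_pos_eq; lra) (delta / (L + 1))) as [N HN].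
  { apply Rdiv_lt_0_compat; lra. }
  specialize (HN N (Nat.le_refl N)).
  assert (P2 : 0 < 2 ^ N) by (apply pow_lt; lra).
  rewrite Rabs_pos_eq in HN by (apply pow_le; lra).
  rewrite pow_inv in HN.
  destruct (inv N) as (I1 & I2 & I3 & I4).
  assert (Hxn := Hx N); assert (Hyn := Hy N).
  assert (SZ : lx / 2 ^ N + ly / 2 ^ N = L * / 2 ^ N) by (unfold L; field; lra).
  assert (small : L * / 2 ^ N < delta).
  { apply Rle_lt_trans with ((L + 1) * / 2 ^ N).
    - apply Rmult_le_compat_r; [left; now apply Rinv_0_lt_compat | lra].
    - apply (Rmult_lt_compat_l (L + 1)) in HN; [|lra].
      replace ((L + 1) * (delta / (L + 1))) with delta in HN by (field; lra).
      exact HN. }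
  assert (B := Hloc (fst (p N)) (fst (p N) + lx / 2 ^ N)
                    (snd (p N)) (snd (p N) + ly / 2 ^ N)
                    ltac:(lra) ltac:(lra) ltac:(lra) ltac:(lra) ltac:(lra)).
  assert (B' := lower N).
  unfold J in B'.
  replace (fst (p N) + lx / 2 ^ N - fst (p N) + (snd (p N) + ly / 2 ^ N - snd (p N)))
    with (L * / 2 ^ N) in B by lra.
  assert (B'' : J0 / 4 ^ N <= eps * (L * / 2 ^ N) ^ 2) by lra.
  replace (4 ^ N) with (2 ^ N * 2 ^ N) in B''
    by (rewrite <- Rpow_mult_distr; f_equal; lra).
  assert (C1 : J0 <= eps * L ^ 2).
  { apply (Rmult_le_compat_r (2 ^ N * 2 ^ N)) in B''; [|nra].
    replace (J0 / (2 ^ N * 2 ^ N) * (2 ^ N * 2 ^ N)) with J0 in B'' by (field; lra).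
    replace (eps * (L * / 2 ^ N) ^ 2 * (2 ^ N * 2 ^ N)) with (eps * L ^ 2) in B''
      by (field; lra).
    exact B''. }
  assert (C2 : eps * (2 * (L ^ 2 + 1)) = J0) by (unfold eps; field; lra).
  nra.
Qed.

(** * Circle means of holomorphic functions *)

(** The quotient-free form of differentiability, which has the same shape as [differentiable_pt_lim]
    and so passes to two real variables directly. *)
Definition C_deriv (f : C -> C) (z l : C) : Prop :=
  forall eps, 0 < eps -> exists delta, 0 < delta /\
  forall w, Cmod (w - z) < delta ->
    Cmod (f w - f z - l * (w - z)) <= eps * Cmod (w - z).

Definition C_cont (f : C -> C) (z : C) : Prop :=
  forall eps, 0 < eps -> exists delta, 0 < delta /\
  forall w, Cmod (w - z) < delta -> Cmod (f w - f z) < eps.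

Lemma C_differentiable_deriv (f : C -> C) (z : C) :
  C_differentiable f z <-> exists l, C_deriv f z l.
Proof.
  split.
  - intros [l [_ H]]; exists l; intros eps Heps.
    destruct (H z (fun P HP => HP) (mkposreal eps Heps)) as [d Hd].
    exists d; split; [apply cond_pos|]; intros w Hw.
    specialize (Hd w Hw); simpl in Hd.
    rewrite (Cmult_comm l); exact Hd.
  - intros [l H]; exists l; split; [apply is_linear_scal_l|].
    intros x Hx eps.
    assert (E : z = x) by exact (is_filter_lim_locally_unique (V := AbsRing_NormedModule C_AbsRing) z x Hx).
    subst x.
    destruct (H eps (cond_pos eps)) as (d & Hd & Hw).
    exists (mkposreal d Hd); intros w Hball.
    specialize (Hw w Hball); rewrite (Cmult_comm l) in Hw; exact Hw.
Qed.

Lemma C_deriv_cont (f : C -> C) (z l : C) : C_deriv f z l -> C_cont f z.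
Proof.
  intros H eps Heps.
  destruct (H 1 ltac:(lra)) as (d & Hd & Hw).
  assert (Hl : 0 < Cmod l + 1) by (pose proof (Cmod_ge_0 l); lra).
  exists (Rmin d (eps / (Cmod l + 1))); split.
  - apply Rmin_case; [exact Hd | now apply Rdiv_lt_0_compat].
  - intros w Hwz.
    assert (h1 := Rlt_le_trans _ _ _ Hwz (Rmin_l _ _)).
    assert (h2 := Rlt_le_trans _ _ _ Hwz (Rmin_r _ _)).
    specialize (Hw w h1).
    replace (f w - f z)%C with ((f w - f z - l * (w - z)) + l * (w - z))%C by ring.
    eapply Rle_lt_trans; [apply Cmod_triangle|]; rewrite Cmod_mult.
    apply (Rmult_lt_compat_l (Cmod l + 1)) in h2; [|exact Hl].
    replace ((Cmod l + 1) * (eps / (Cmod l + 1))) with eps in h2 by (field; lra).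
    lra.
Qed.

Lemma im_le_Cmod (c : C) : Rabs (snd c) <= Cmod c.
Proof.
  rewrite <- (Cmod_opp c), <- Rabs_Ropp.
  replace (- snd c) with (Re (- c * - Ci)) by (destruct c; simpl; ring).
  eapply Rle_trans; [apply re_le_Cmod|].
  rewrite Cmod_mult, (Cmod_opp Ci).
  replace (Cmod Ci) with 1; [lra|].
  unfold Cmod; simpl; replace (0 * (0 * 1) + 1 * (1 * 1)) with 1 by ring.
  now rewrite sqrt_1.
Qed.

Lemma Cmod_le_2Rmax (x y : R) : Cmod (x, y) <= 2 * Rmax (Rabs x) (Rabs y).
Proof.
  eapply Rle_trans; [apply Cmod_2Rmax|]; simpl.
  apply Rmult_le_compat_r.
  - eapply Rle_trans; [apply Rabs_pos | apply Rmax_l].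
  - left; apply sqrt_less; lra.
Qed.

Lemma Cminus_pair (x y x' y' : R) : ((x, y) - (x', y'))%C = (x - x', y - y').
Proof. reflexivity. Qed.

Lemma C_cont_2d (g : C -> C) (x y : R) :
  C_cont g (x, y) ->
  continuity_2d_pt (fun u v => fst (g (u, v))) x y /\
  continuity_2d_pt (fun u v => snd (g (u, v))) x y.
Proof.
  intros H.
  assert (K : forall eps : posreal, locally_2d (fun u v => Cmod (g (u, v) - g (x, y)) < eps) x y).
  { intros eps; destruct (H eps (cond_pos eps)) as (d & Hd & Hw).
    assert (Hd2 : 0 < d / 2) by lra; exists (mkposreal _ Hd2); simpl; intros u v Hu Hv.
    apply Hw; rewrite Cminus_pair.
    eapply Rle_lt_trans; [apply Cmod_le_2Rmax|].
    apply Rmax_case; lra. }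
  split; intros eps; destruct (K eps) as [d Hd]; exists d; intros u v Hu Hv;
    specialize (Hd u v Hu Hv); eapply Rle_lt_trans; try exact Hd.
  - exact (re_le_Cmod (g (u, v) - g (x, y))).
  - exact (im_le_Cmod (g (u, v) - g (x, y))).
Qed.

(** The Cauchy-Riemann equations: the real differential is multiplication by [l], whose matrix has
    rows ([fst l], [- snd l]) and ([snd l], [fst l]). *)
Lemma C_deriv_2d (g : C -> C) (x y : R) (l : C) :
  C_deriv g (x, y) l ->
  differentiable_pt_lim (fun u v => fst (g (u, v))) x y (fst l) (- snd l) /\
  differentiable_pt_lim (fun u v => snd (g (u, v))) x y (snd l) (fst l).
Proof.
  intros H.
  assert (K : forall eps : posreal, locally_2d (fun u v =>
     Cmod (g (u, v) - g (x, y) - l * ((u, v) - (x, y)))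
       <= eps * Rmax (Rabs (u - x)) (Rabs (v - y))) x y).
  { intros eps; assert (He : 0 < eps / 2) by (pose proof (cond_pos eps); lra).
    destruct (H _ He) as (d & Hd & Hw).
    assert (Hd2 : 0 < d / 2) by lra; exists (mkposreal _ Hd2); simpl; intros u v Hu Hv.
    pose proof (Cmod_le_2Rmax (u - x) (v - y)) as B.
    assert (B' : Rmax (Rabs (u - x)) (Rabs (v - y)) < d / 2) by (apply Rmax_case; lra).
    eapply Rle_trans; [apply Hw; rewrite Cminus_pair; lra|].
    rewrite Cminus_pair.
    apply (Rmult_le_compat_l (eps / 2)) in B; lra. }
  split; intros eps; destruct (K eps) as [d Hd]; exists d; intros u v Hu Hv;
    specialize (Hd u v Hu Hv); eapply Rle_trans; try exact Hd.
  - eapply Rle_trans; [|apply re_le_Cmod]; right; f_equal; simpl; ring.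
  - eapply Rle_trans; [|apply im_le_Cmod]; right; f_equal; simpl; ring.
Qed.

Definition polar (r t : R) : C := (r * cos t, r * sin t).

Lemma Cmod_polar (r t : R) : 0 <= r -> Cmod (polar r t) = r.
Proof.
  intros Hr; unfold Cmod, polar; simpl.
  replace (_ + _) with (Rsqr r * (Rsqr (sin t) + Rsqr (cos t))) by (unfold Rsqr; ring).
  rewrite sin2_cos2, Rmult_1_r; now apply sqrt_Rsqr.
Qed.

Lemma differentiable_pt_lim_mul (f g : R -> R) (x y lf lg : R) :
  derivable_pt_lim f x lf -> derivable_pt_lim g y lg ->
  differentiable_pt_lim (fun u v => f u * g v) x y (lf * g y) (f x * lg).
Proof.
  intros Hf Hg.
  assert (D : forall a b, differentiable_pt_lim (fun u v => u * v) a b b a).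
  { intros a b eps; exists eps; intros u v Hu Hv.
    replace (u * v - a * b - (b * (u - a) + a * (v - b))) with ((u - a) * (v - b)) by ring.
    rewrite Rabs_mult; apply Rmult_le_compat; try apply Rabs_pos; [lra | apply Rmax_r]. }
  assert (P2 : differentiable_pt_lim (fun _ v => v) x y 0 1).
  { intros eps; exists eps; intros u v _ _.
    replace (v - y - (0 * (u - x) + 1 * (v - y))) with 0 by ring; rewrite Rabs_R0.
    apply Rmult_le_pos; [left; apply cond_pos|].
    eapply Rle_trans; [apply Rabs_pos | apply Rmax_l]. }
  assert (G : differentiable_pt_lim (fun _ v => g v) x y 0 lg).
  { replace lg with (lg * 1 + 0 * 1) by ring.
    replace 0 with (lg * 0 + 0 * 0) at 1 by ring.
    apply (differentiable_pt_lim_comp (fun u _ => g u) (fun _ v => v) (fun _ v => v));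
      [|exact P2|exact P2].
    now apply differentiable_pt_lim_proj1_0. }
  replace (lf * g y) with (g y * lf + f x * 0) by ring.
  replace (f x * lg) with (g y * 0 + f x * lg) by ring.
  apply (differentiable_pt_lim_comp (fun u v => u * v) (fun u _ => f u) (fun _ v => g v));
    [apply D | now apply differentiable_pt_lim_proj1_0 | exact G].
Qed.

(* In the logarithmic coordinates [w = e^(s + i t)] circles become vertical
   segments, and the horizontal sides of [s1, s2] x [0, 2 pi] cancel. *)
Lemma circle_integral_const (g : C -> C) (r1 r2 : R) :
  0 < r1 -> r1 <= r2 ->
  (forall w, r1 <= Cmod w <= r2 -> exists l, C_deriv g w l) ->
  RInt (fun t => fst (g (polar r1 t))) 0 (2 * PI) =
    RInt (fun t => fst (g (polar r2 t))) 0 (2 * PI) /\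
  RInt (fun t => snd (g (polar r1 t))) 0 (2 * PI) =
    RInt (fun t => snd (g (polar r2 t))) 0 (2 * PI).
Proof.
  intros Hr1 Hr Hg.
  set (U := fun s t => fst (g (polar (exp s) t))).
  set (V := fun s t => snd (g (polar (exp s) t))).
  (* The Cauchy-Riemann equations for w = exp (s + i t) composed with [g], by the chain rule. *)
  assert (D : forall s t, ln r1 <= s <= ln r2 -> exists p q,
    differentiable_pt_lim U s t p (- q) /\ differentiable_pt_lim V s t q p).
  { intros s t Hs.
    destruct (Hg (polar (exp s) t)) as [l Hl].
    { rewrite Cmod_polar by (left; apply exp_pos).
      rewrite <- (exp_ln r1), <- (exp_ln r2) by lra.
      split; destruct Hs as [[h|h] [h'|h']];
        try (left; now apply exp_increasing); right; now f_equal. }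
    destruct (C_deriv_2d _ _ _ _ Hl) as [Hu Hv].
    assert (DX : differentiable_pt_lim (fun s t => exp s * cos t) s t
                   (exp s * cos t) (exp s * - sin t))
      by (apply differentiable_pt_lim_mul; [apply derivable_pt_lim_exp | apply derivable_pt_lim_cos]).
    assert (DY : differentiable_pt_lim (fun s t => exp s * sin t) s t
                   (exp s * sin t) (exp s * cos t))
      by (apply differentiable_pt_lim_mul; [apply derivable_pt_lim_exp | apply derivable_pt_lim_sin]).
    exists (fst l * (exp s * cos t) + - snd l * (exp s * sin t)),
           (snd l * (exp s * cos t) + fst l * (exp s * sin t)).
    split.
    - replace (- (_ + _)) with (fst l * (exp s * - sin t) + - snd l * (exp s * cos t)) by ring.
      exact (differentiable_pt_lim_comp _ _ _ _ _ _ _ _ _ _ _ Hu DX DY).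
    - replace (fst l * (exp s * cos t) + _)
        with (snd l * (exp s * - sin t) + fst l * (exp s * cos t)) by ring.
      exact (differentiable_pt_lim_comp _ _ _ _ _ _ _ _ _ _ _ Hv DX DY). }
  assert (Hln : ln r1 <= ln r2)
    by (destruct Hr as [h| ->]; [left; now apply ln_increasing | lra]).
  pose proof PI_RGT_0.
  assert (per : forall s, polar s (2 * PI) = polar s 0)
    by (intros s; unfold polar; now rewrite cos_2PI, sin_2PI, cos_0, sin_0).
  (* Since (U + i V)(ds + i dt) = (U ds - V dt) + i (V ds + U dt), [I1] and [I2] are the imaginary
     and the real part of one complex contour integral. *)
  assert (I1 : rect_int V U (ln r1) (ln r2) 0 (2 * PI) = 0).
  { apply goursat_rect; [exact Hln | lra |]; intros s t Hs _.
    destruct (D s t Hs) as (p & q & A1 & A2); now exists q, p, (- q). }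
  assert (I2 : rect_int U (fun s t => - V s t) (ln r1) (ln r2) 0 (2 * PI) = 0).
  { apply goursat_rect; [exact Hln | lra |]; intros s t Hs _.
    destruct (D s t Hs) as (p & q & A1 & A2); exists p, (- q), (- p); split; [exact A1|].
    intros eps; destruct (A2 eps) as [d Hd]; exists d; intros u v Hu Hv.
    rewrite <- Rabs_Ropp; eapply Rle_trans; [|apply (Hd u v Hu Hv)].
    right; f_equal; ring. }
  unfold rect_int in I1, I2.
  assert (EV : RInt (fun x => V x 0) (ln r1) (ln r2) =
               RInt (fun x => V x (2 * PI)) (ln r1) (ln r2))
    by (apply RInt_ext; intros x _; unfold V; now rewrite per).
  assert (EU : RInt (fun x => U x 0) (ln r1) (ln r2) =
               RInt (fun x => U x (2 * PI)) (ln r1) (ln r2))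
    by (apply RInt_ext; intros x _; unfold U; now rewrite per).
  assert (exV : forall s, ln r1 <= s <= ln r2 -> ex_RInt (fun t => V s t) 0 (2 * PI)).
  { intros s Hs; apply (ex_RInt_continuous (V := R_CompleteNormedModule)); intros t _.
    apply (continuity_2d_continuous_snd V).
    destruct (D s t Hs) as (p & q & _ & A2).
    exact (differentiable_pt_lim_continuity_2d _ _ _ _ _ A2). }
  assert (N : forall s, ln r1 <= s <= ln r2 ->
     RInt (fun t => - V s t) 0 (2 * PI) = - RInt (fun t => V s t) 0 (2 * PI)).
  { intros s Hs; apply (RInt_opp (V := R_CompleteNormedModule)); now apply exV. }
  rewrite !N in I2 by lra.
  unfold U, V in *.
  rewrite !exp_ln in I1, I2 by lra.
  split; lra.
Qed.

Lemma RInt_param_continuous (f : R -> R -> R) (a b x1 x2 : R) :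
  a <= b ->
  (forall x y, x1 <= x <= x2 -> a <= y <= b -> continuity_2d_pt f x y) ->
  forall x, x1 <= x <= x2 -> forall eps, 0 < eps -> exists delta, 0 < delta /\
  forall x', x1 <= x' <= x2 -> Rabs (x' - x) < delta ->
    Rabs (RInt (f x') a b - RInt (f x) a b) < eps.
Proof.
  intros Hab Hf x Hx eps Heps.
  assert (He : 0 < eps / (2 * (b - a + 1))) by (apply Rdiv_lt_0_compat; lra).
  destruct (uniform_continuity_2d f x1 x2 a b Hf (mkposreal _ He)) as [d Hd].
  exists d; split; [apply cond_pos|]; intros x' Hx' Hxx.
  assert (ex : forall z, x1 <= z <= x2 -> ex_RInt (f z) a b).
  { intros z Hz; apply (ex_RInt_continuous (V := R_CompleteNormedModule)); intros t Ht.
    apply (continuity_2d_continuous_snd f), Hf; [exact Hz|].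
    rewrite Rmin_left, Rmax_right in Ht; lra. }
  assert (B : Rabs (RInt (f x') a b - RInt (f x) a b)
              <= (b - a) * (eps / (2 * (b - a + 1)))).
  { rewrite <- (RInt_minus (V := R_CompleteNormedModule) (f x') (f x)) by now apply ex.
    apply abs_RInt_le_const; [exact Hab | |].
    - apply (ex_RInt_minus (V := R_CompleteNormedModule)); now apply ex.
    - intros t Ht; left; apply (Hd x t x' t); try assumption.
      rewrite Rminus_diag, Rabs_R0; apply cond_pos. }
  assert (E : eps / (2 * (b - a + 1)) * (2 * (b - a + 1)) = eps) by (field; lra).
  nra.
Qed.

(** Continuity carries the constant value across the two radii that the annulus argument misses, 0
    and [rho]. The auxiliary [right] and [left] extend a constant to the lower and to the upper
    endpoint of an interval. The radius [rho] may itself be 0, in which case one extension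
    suffices. *)
Lemma piecewise_const_continuous (m : R -> R) (rho R1 : R) :
  (forall x, 0 <= x <= R1 -> forall eps, 0 < eps -> exists delta, 0 < delta /\
     forall x', 0 <= x' <= R1 -> Rabs (x' - x) < delta -> Rabs (m x' - m x) < eps) ->
  (forall r1 r2, 0 < r1 -> r1 <= r2 -> r2 <= R1 -> (r2 < rho \/ rho < r1) -> m r1 = m r2) ->
  forall r, 0 <= r <= R1 -> m r = m 0.
Proof.
  intros Hc Hk.
  assert (right : forall x y, 0 <= x -> x < y -> y <= R1 ->
            (forall z, x < z -> z <= y -> m z = m y) -> m x = m y).
  { intros x y Hx Hxy Hy Hz.
    destruct (Req_dec (m x) (m y)) as [E|NE]; [exact E|exfalso].
    destruct (Hc x ltac:(lra) (Rabs (m y - m x))) as (d & Hd & H).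
    { apply Rabs_pos_lt; lra. }
    set (z := Rmin y (x + d / 2)).
    assert (x < z) by (unfold z; apply Rmin_case; lra).
    assert (z <= y) by apply Rmin_l.
    assert (z <= x + d / 2) by apply Rmin_r.
    assert (A := H z ltac:(lra) ltac:(rewrite Rabs_pos_eq; lra)).
    rewrite (Hz z) in A by lra; lra. }
  assert (left : forall x y, 0 <= x -> x < y -> y <= R1 ->
            (forall z, x <= z -> z < y -> m z = m x) -> m x = m y).
  { intros x y Hx Hxy Hy Hz.
    destruct (Req_dec (m x) (m y)) as [E|NE]; [exact E|exfalso].
    destruct (Hc y ltac:(lra) (Rabs (m x - m y))) as (d & Hd & H).
    { apply Rabs_pos_lt; lra. }
    set (z := Rmax x (y - d / 2)).
    assert (z < y) by (unfold z; apply Rmax_case; lra).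
    assert (x <= z) by apply Rmax_l.
    assert (y - d / 2 <= z) by apply Rmax_r.
    assert (A := H z ltac:(lra) ltac:(rewrite Rabs_left; lra)).
    rewrite (Hz z) in A by lra; lra. }
  intros r [[Hr|<-] HrR]; [|reflexivity].
  assert (low : forall s, 0 < s -> s <= R1 -> s < rho -> m s = m 0).
  { intros s Hs HsR Hsr; symmetry; apply right; try lra.
    intros z Hz1 Hz2; apply Hk; lra. }
  destruct (Rlt_le_dec r rho) as [h|[h|h]]; [now apply low| |].
  - destruct (Rle_lt_dec rho 0) as [h0|h0].
    + symmetry; apply right; try lra; intros z Hz1 Hz2; apply Hk; lra.
    + transitivity (m rho).
      * symmetry; apply right; try lra; intros z Hz1 Hz2; apply Hk; lra.
      * symmetry; apply left; try lra.
        intros z [Hz1|<-] Hz2; [apply low; lra | reflexivity].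
  - subst rho; symmetry; apply left; try lra.
    intros z [Hz1|<-] Hz2; [apply low; lra | reflexivity].
Qed.

Lemma continuity_2d_polar (u : R -> R -> R) (r t : R) :
  continuity_2d_pt u (r * cos t) (r * sin t) ->
  continuity_2d_pt (fun r t => u (r * cos t) (r * sin t)) r t.
Proof.
  intros H eps; destruct (H eps) as [d Hd].
  assert (X : continuity_2d_pt (fun r t => r * cos t) r t).
  { apply continuity_2d_pt_mult; [apply continuity_2d_pt_id1|].
    apply (continuity_1d_2d_pt_comp cos (fun _ t => t));
      [apply continuity_cos | apply continuity_2d_pt_id2]. }
  assert (Y : continuity_2d_pt (fun r t => r * sin t) r t).
  { apply continuity_2d_pt_mult; [apply continuity_2d_pt_id1|].
    apply (continuity_1d_2d_pt_comp sin (fun _ t => t));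
      [apply continuity_sin | apply continuity_2d_pt_id2]. }
  destruct (X d) as [d1 H1]; destruct (Y d) as [d2 H2].
  assert (H3 : 0 < Rmin d1 d2) by (apply Rmin_case; apply cond_pos).
  exists (mkposreal _ H3); simpl; intros u' v' A B.
  pose proof (Rmin_l d1 d2); pose proof (Rmin_r d1 d2).
  apply Hd; [apply H1 | apply H2]; lra.
Qed.

(** The mean does not depend on the radius, and at radius 0 the integrand is the constant [g 0].
    Differentiability is waived on all of |w| = rho to admit a function with one doubtful point on
    that circle. *)
Lemma mean_value (g : C -> C) (rho : R) :
  (forall w, Cmod w < 1 -> C_cont g w) ->
  (forall w, Cmod w < 1 -> Cmod w <> rho -> exists l, C_deriv g w l) ->
  forall r, 0 <= r < 1 ->
  RInt (fun t => fst (g (polar r t))) 0 (2 * PI) = 2 * PI * fst (g 0) /\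
  RInt (fun t => snd (g (polar r t))) 0 (2 * PI) = 2 * PI * snd (g 0).
Proof.
  intros Hc Hd r Hr; pose proof PI_RGT_0.
  assert (P0 : forall t, polar 0 t = RtoC 0) by (intros t; unfold polar, RtoC; f_equal; ring).
  assert (cst : forall k, RInt (fun _ => k) 0 (2 * PI) = 2 * PI * k).
  { intros k; rewrite RInt_const; unfold scal; simpl; unfold mult; simpl; ring. }
  assert (C2 : forall x y, 0 <= x <= r -> 0 <= y <= 2 * PI ->
     continuity_2d_pt (fun r t => fst (g (polar r t))) x y /\
     continuity_2d_pt (fun r t => snd (g (polar r t))) x y).
  { intros x y Hx Hy.
    destruct (C_cont_2d g (x * cos y) (x * sin y)) as [A B].
    { apply Hc; fold (polar x y); rewrite Cmod_polar; lra. }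
    split.
    - exact (continuity_2d_polar (fun u v => fst (g (u, v))) x y A).
    - exact (continuity_2d_polar (fun u v => snd (g (u, v))) x y B). }
  assert (K : forall r1 r2, 0 < r1 -> r1 <= r2 -> r2 <= r -> (r2 < rho \/ rho < r1) ->
    forall w, r1 <= Cmod w <= r2 -> exists l, C_deriv g w l)
    by (intros; apply Hd; lra).
  split; rewrite <- cst.
  - transitivity (RInt (fun t => fst (g (polar 0 t))) 0 (2 * PI)).
    + apply (piecewise_const_continuous
               (fun r => RInt (fun t => fst (g (polar r t))) 0 (2 * PI)) rho r).
      * apply (RInt_param_continuous (fun r t => fst (g (polar r t)))); [lra|].
        intros; now apply C2.
      * intros r1 r2 h1 h2 h3 h4; exact (proj1 (circle_integral_const g r1 r2 h1 h2 (K r1 r2 h1 h2 h3 h4))).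
      * lra.
    + apply RInt_ext; intros t _; now rewrite P0.
  - transitivity (RInt (fun t => snd (g (polar 0 t))) 0 (2 * PI)).
    + apply (piecewise_const_continuous
               (fun r => RInt (fun t => snd (g (polar r t))) 0 (2 * PI)) rho r).
      * apply (RInt_param_continuous (fun r t => snd (g (polar r t)))); [lra|].
        intros; now apply C2.
      * intros r1 r2 h1 h2 h3 h4; exact (proj2 (circle_integral_const g r1 r2 h1 h2 (K r1 r2 h1 h2 h3 h4))).
      * lra.
    + apply RInt_ext; intros t _; now rewrite P0.
Qed.

(** * Rules for pointwise continuity and derivatives, and the difference quotient *)

Lemma C_cont_plus (f g : C -> C) (z : C) :
  C_cont f z -> C_cont g z -> C_cont (fun w => f w + g w)%C z.
Proof.
  intros Hf Hg eps Heps.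
  destruct (Hf (eps / 2) ltac:(lra)) as (d1 & Hd1 & H1).
  destruct (Hg (eps / 2) ltac:(lra)) as (d2 & Hd2 & H2).
  exists (Rmin d1 d2); split; [now apply Rmin_case|]; intros w Hw.
  specialize (H1 w (Rlt_le_trans _ _ _ Hw (Rmin_l _ _))).
  specialize (H2 w (Rlt_le_trans _ _ _ Hw (Rmin_r _ _))).
  replace (f w + g w - (f z + g z))%C with ((f w - f z) + (g w - g z))%C by ring.
  eapply Rle_lt_trans; [apply Cmod_triangle | lra].
Qed.

Lemma C_cont_scal (c : C) (f : C -> C) (z : C) :
  C_cont f z -> C_cont (fun w => c * f w)%C z.
Proof.
  intros Hf eps Heps; pose proof (Cmod_ge_0 c).
  destruct (Hf (eps / (Cmod c + 1))) as (d & Hd & H1); [apply Rdiv_lt_0_compat; lra|].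
  exists d; split; [exact Hd|]; intros w Hw; specialize (H1 w Hw).
  replace (c * f w - c * f z)%C with (c * (f w - f z))%C by ring.
  rewrite Cmod_mult.
  assert (E : eps / (Cmod c + 1) * (Cmod c + 1) = eps) by (field; lra).
  pose proof (Cmod_ge_0 (f w - f z)); nra.
Qed.

Lemma C_deriv_plus (f g : C -> C) (z lf lg : C) :
  C_deriv f z lf -> C_deriv g z lg -> C_deriv (fun w => f w + g w)%C z (lf + lg)%C.
Proof.
  intros Hf Hg eps Heps.
  destruct (Hf (eps / 2) ltac:(lra)) as (d1 & Hd1 & H1).
  destruct (Hg (eps / 2) ltac:(lra)) as (d2 & Hd2 & H2).
  exists (Rmin d1 d2); split; [now apply Rmin_case|]; intros w Hw.
  specialize (H1 w (Rlt_le_trans _ _ _ Hw (Rmin_l _ _))).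
  specialize (H2 w (Rlt_le_trans _ _ _ Hw (Rmin_r _ _))).
  replace (f w + g w - (f z + g z) - (lf + lg) * (w - z))%C
    with ((f w - f z - lf * (w - z)) + (g w - g z - lg * (w - z)))%C by ring.
  eapply Rle_trans; [apply Cmod_triangle | lra].
Qed.

Lemma C_deriv_scal (c : C) (f : C -> C) (z l : C) :
  C_deriv f z l -> C_deriv (fun w => c * f w)%C z (c * l)%C.
Proof.
  intros Hf eps Heps; pose proof (Cmod_ge_0 c).
  destruct (Hf (eps / (Cmod c + 1))) as (d & Hd & H1); [apply Rdiv_lt_0_compat; lra|].
  exists d; split; [exact Hd|]; intros w Hw; specialize (H1 w Hw).
  replace (c * f w - c * f z - c * l * (w - z))%C
    with (c * (f w - f z - l * (w - z)))%C by ring.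
  rewrite Cmod_mult.
  assert (E : eps / (Cmod c + 1) * (Cmod c + 1) = eps) by (field; lra).
  assert (0 < eps / (Cmod c + 1)) by (apply Rdiv_lt_0_compat; lra).
  pose proof (Cmod_ge_0 (f w - f z - l * (w - z))); pose proof (Cmod_ge_0 (w - z)).
  apply Rle_trans with (Cmod c * (eps / (Cmod c + 1) * Cmod (w - z))).
  - now apply Rmult_le_compat_l.
  - rewrite <- E at 2.
    replace (eps / (Cmod c + 1) * (Cmod c + 1) * Cmod (w - z))
      with (Cmod c * (eps / (Cmod c + 1) * Cmod (w - z)) + eps / (Cmod c + 1) * Cmod (w - z))
      by ring.
    assert (0 <= eps / (Cmod c + 1) * Cmod (w - z)) by (apply Rmult_le_pos; lra).
    lra.
Qed.

Definition slope (f : C -> C) (z0 l : C) (w : C) : C :=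
  if Ceq_dec w z0 then l else ((f w - f z0) / (w - z0))%C.

Lemma slope_cont (f : C -> C) (z0 l : C) : C_deriv f z0 l -> C_cont (slope f z0 l) z0.
Proof.
  intros H eps Heps.
  destruct (H (eps / 2) ltac:(lra)) as (d & Hd & Hw).
  exists d; split; [exact Hd|]; intros w Hwz; specialize (Hw w Hwz).
  unfold slope; destruct (Ceq_dec z0 z0) as [_|n]; [|now elim n].
  destruct (Ceq_dec w z0) as [->|Hne].
  - replace (l - l)%C with (RtoC 0) by ring; rewrite Cmod_0; lra.
  - assert (N : (w - z0)%C <> 0) by now apply Cminus_eq_contra.
    replace ((f w - f z0) / (w - z0) - l)%C
      with ((f w - f z0 - l * (w - z0)) / (w - z0))%C by now field.
    rewrite Cmod_div by exact N.
    assert (0 < Cmod (w - z0)) by now apply Cmod_gt_0.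
    apply Rle_lt_trans with (eps / 2); [|lra].
    apply Rle_div_l; lra.
Qed.

(** The quotient rule away from [z0]. With [k] the slope at [z], the error of the linear
    approximation is the remainder of [f] minus m (w - z)^2, all divided by w - z0. *)
Lemma slope_deriv (f : C -> C) (z0 l z df : C) :
  z <> z0 -> C_deriv f z df -> exists m, C_deriv (slope f z0 l) z m.
Proof.
  intros Hz H.
  assert (N : (z - z0)%C <> 0) by now apply Cminus_eq_contra.
  assert (Hp : 0 < Cmod (z - z0)) by now apply Cmod_gt_0.
  set (a := Cmod (z - z0)) in *.
  set (k := ((f z - f z0) / (z - z0))%C).
  set (m := ((df - k) / (z - z0))%C).
  exists m; intros eps Heps.
  destruct (H (eps * a / 4)) as (d & Hd & Hw); [nra|].
  pose proof (Cmod_ge_0 m) as Hm.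
  (* Both parts of the numerator are kept below (eps a / 4) |w - z|: the remainder of [f] by [d],
     the quadratic term by [d']. The bound a / 2 on |w - z| keeps the denominator at least a / 2. *)
  set (d' := eps * a / (4 * (Cmod m + 1))).
  assert (Hd' : 0 < d') by (unfold d'; apply Rdiv_lt_0_compat; nra).
  exists (Rmin d (Rmin (a / 2) d')); split; [repeat apply Rmin_case; lra|].
  intros w Hwz.
  assert (h1 := Rlt_le_trans _ _ _ Hwz (Rmin_l _ _)).
  assert (h2 := Rlt_le_trans _ _ _ Hwz (Rmin_r _ _)).
  assert (h3 := Rlt_le_trans _ _ _ h2 (Rmin_r _ _)).
  apply (fun h => Rlt_le_trans _ _ _ h (Rmin_l _ _)) in h2.
  specialize (Hw w h1); clear Hwz h1.
  assert (far : a / 2 <= Cmod (w - z0)).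
  { assert (T := Cmod_triangle (w - z0) (- (w - z))).
    replace (w - z0 + - (w - z))%C with (z - z0)%C in T by ring.
    rewrite Cmod_opp in T; fold a in T; lra. }
  assert (Nw : (w - z0)%C <> 0) by (apply Cmod_gt_0; lra).
  unfold slope; destruct (Ceq_dec z z0) as [e|_]; [contradiction|].
  destruct (Ceq_dec w z0) as [e|_]; [subst w; elim Nw; ring|].
  fold k.
  replace ((f w - f z0) / (w - z0) - k - m * (w - z))%C
    with (((f w - f z - df * (w - z)) - m * (w - z) * (w - z)) / (w - z0))%C
    by (unfold m, k; field; split; assumption).
  rewrite Cmod_div by exact Nw.
  apply Rle_div_l; [lra|].
  eapply Rle_trans; [apply Cmod_triangle|].
  rewrite Cmod_opp, !Cmod_mult.
  assert (E : d' * (4 * (Cmod m + 1)) = eps * a) by (unfold d'; field; lra).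
  pose proof (Cmod_ge_0 (w - z)) as Hn.
  set (n := Cmod (w - z)) in *.
  assert (B : Cmod m * n <= eps * a / 4) by nra.
  apply Rle_trans with (eps * a / 4 * n + eps * a / 4 * n).
  - apply Rplus_le_compat; [exact Hw | now apply Rmult_le_compat_r].
  - assert (0 <= eps * n) by (apply Rmult_le_pos; lra).
    apply Rle_trans with (eps * n * (a / 2)); [lra | now apply Rmult_le_compat_l].
Qed.

(** * Complex integrals over the circle *)

Definition is_CInt (h : R -> C) (l : C) : Prop :=
  is_RInt (fun t => fst (h t)) 0 (2 * PI) (fst l) /\
  is_RInt (fun t => snd (h t)) 0 (2 * PI) (snd l).

Definition C_cont_path (h : R -> C) : Prop :=
  forall t, continuous (fun t => fst (h t)) t /\ continuous (fun t => snd (h t)) t.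

Definition CInt (h : R -> C) : C :=
  (RInt (fun t => fst (h t)) 0 (2 * PI), RInt (fun t => snd (h t)) 0 (2 * PI)).

Lemma CInt_correct (h : R -> C) : C_cont_path h -> is_CInt h (CInt h).
Proof.
  intros H; split; apply (RInt_correct (V := R_CompleteNormedModule));
    apply (ex_RInt_continuous (V := R_CompleteNormedModule)); intros t _; apply H.
Qed.

Lemma is_CInt_unique (h : R -> C) (l l' : C) : is_CInt h l -> is_CInt h l' -> l = l'.
Proof.
  intros [A1 A2] [B1 B2]; apply injective_projections.
  - now rewrite <- (is_RInt_unique _ _ _ _ A1), <- (is_RInt_unique _ _ _ _ B1).
  - now rewrite <- (is_RInt_unique _ _ _ _ A2), <- (is_RInt_unique _ _ _ _ B2).
Qed.

Lemma is_CInt_ext (h k : R -> C) (l : C) :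
  (forall t, h t = k t) -> is_CInt h l -> is_CInt k l.
Proof.
  intros E [A1 A2]; split.
  - apply (is_RInt_ext (V := R_NormedModule) (fun t => fst (h t))); [|exact A1].
    intros t _; now rewrite E.
  - apply (is_RInt_ext (V := R_NormedModule) (fun t => snd (h t))); [|exact A2].
    intros t _; now rewrite E.
Qed.

Lemma is_CInt_plus (h k : R -> C) (l m : C) :
  is_CInt h l -> is_CInt k m -> is_CInt (fun t => h t + k t)%C (l + m)%C.
Proof.
  intros [A1 A2] [B1 B2]; split; apply (is_RInt_plus (V := R_NormedModule)); assumption.
Qed.

Lemma is_CInt_scal (c : C) (h : R -> C) (l : C) :
  is_CInt h l -> is_CInt (fun t => c * h t)%C (c * l)%C.
Proof.
  intros [A1 A2]; split; simpl.
  - apply (is_RInt_minus (V := R_NormedModule));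
      now apply (is_RInt_scal (V := R_NormedModule)).
  - apply (is_RInt_plus (V := R_NormedModule));
      now apply (is_RInt_scal (V := R_NormedModule)).
Qed.

Lemma is_CInt_sum (h : nat -> R -> C) (l : nat -> C) (N : nat) :
  (forall n, is_CInt (h n) (l n)) ->
  is_CInt (fun t => sum_n (fun n => h n t) N) (sum_n l N).
Proof.
  intros H; induction N as [|N IH].
  - rewrite sum_O; apply (is_CInt_ext (h 0%nat)); [|apply H].
    intros t; now rewrite sum_O.
  - rewrite sum_Sn; apply (is_CInt_ext (fun t => sum_n (fun n => h n t) N + h (S N) t)%C).
    + intros t; now rewrite sum_Sn.
    + now apply is_CInt_plus.
Qed.

(** The components are bounded separately and recombined by [Cmod_le_2Rmax], which accounts for 4 pi
    in place of the sharp 2 pi. *)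
Lemma is_CInt_bound (h : R -> C) (l : C) (M : R) :
  is_CInt h l -> (forall t, 0 <= t <= 2 * PI -> Cmod (h t) <= M) -> Cmod l <= 4 * PI * M.
Proof.
  intros [A1 A2] HM; pose proof PI_RGT_0.
  assert (B1 : Rabs (fst l) <= (2 * PI - 0) * M).
  { apply (norm_RInt_le_const (V := R_NormedModule) (fun t => fst (h t))); [lra | | exact A1].
    intros t Ht; eapply Rle_trans; [apply re_le_Cmod | now apply HM]. }
  assert (B2 : Rabs (snd l) <= (2 * PI - 0) * M).
  { apply (norm_RInt_le_const (V := R_NormedModule) (fun t => snd (h t))); [lra | | exact A2].
    intros t Ht; eapply Rle_trans; [apply im_le_Cmod | now apply HM]. }
  destruct l as [x y]; simpl in B1, B2.
  eapply Rle_trans; [apply Cmod_le_2Rmax|].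
  assert (Rmax (Rabs x) (Rabs y) <= (2 * PI - 0) * M) by now apply Rmax_lub.
  lra.
Qed.

Lemma C_cont_path_mult (h k : R -> C) :
  C_cont_path h -> C_cont_path k -> C_cont_path (fun t => h t * k t)%C.
Proof.
  intros Hh Hk t; destruct (Hh t) as [A1 A2]; destruct (Hk t) as [B1 B2]; split; simpl.
  - apply (continuous_minus (V := R_NormedModule));
      now apply (continuous_mult (K := R_AbsRing)).
  - apply (continuous_plus (V := R_NormedModule));
      now apply (continuous_mult (K := R_AbsRing)).
Qed.

Lemma C_cont_path_polar (g : C -> C) (r : R) :
  0 <= r -> (forall w, Cmod w = r -> C_cont g w) -> C_cont_path (fun t => g (polar r t)).
Proof.
  intros Hr H t.
  destruct (C_cont_2d g (r * cos t) (r * sin t)) as [A B].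
  { apply H; now apply (Cmod_polar r t). }
  split.
  - apply (continuity_2d_continuous_snd (fun r t => fst (g (polar r t)))).
    exact (continuity_2d_polar (fun u v => fst (g (u, v))) r t A).
  - apply (continuity_2d_continuous_snd (fun r t => snd (g (polar r t)))).
    exact (continuity_2d_polar (fun u v => snd (g (u, v))) r t B).
Qed.

Lemma polar_mult (r s t u : R) : (polar r t * polar s u)%C = polar (r * s) (t + u).
Proof.
  unfold polar; rewrite cos_plus, sin_plus; unfold Cmult; simpl; f_equal; ring.
Qed.

Lemma polar_pow (r t : R) (n : nat) : (polar r t ^ n)%C = polar (r ^ n) (INR n * t).
Proof.
  induction n as [|n IH].
  - unfold polar; simpl; rewrite Rmult_0_l, cos_0, sin_0; unfold RtoC; f_equal; ring.
  - rewrite Cpow_S, IH, polar_mult, S_INR; f_equal; ring.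
Qed.

Lemma polar_inv (r t : R) : 0 < r -> (/ polar r t)%C = polar (/ r) (- t).
Proof.
  intros Hr.
  assert (N : polar r t <> 0) by (apply Cmod_gt_0; rewrite Cmod_polar; lra).
  transitivity (/ polar r t * (polar r t * polar (/ r) (- t)))%C.
  - rewrite polar_mult, Rinv_r, Rplus_opp_r by lra.
    unfold polar; rewrite cos_0, sin_0.
    replace (1 * 1, 1 * 0) with (RtoC 1) by (unfold RtoC; f_equal; ring); ring.
  - rewrite Cmult_assoc, Cinv_l by exact N; ring.
Qed.

(** Orthogonality of the exponentials: for n > 0 both components have a primitive of period 2 pi. On
    [nat] the [then] branch is the case n = 0. *)
Lemma is_CInt_inv_pow (r : R) (n : nat) :
  0 < r -> is_CInt (fun t => (/ polar r t) ^ n)%C (if n then RtoC (2 * PI) else RtoC 0).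
Proof.
  intros Hr.
  apply (is_CInt_ext (fun t => polar ((/ r) ^ n) (- (INR n * t)))).
  { intros t; rewrite polar_inv, polar_pow by exact Hr; f_equal; ring. }
  destruct n as [|n].
  - split; simpl.
    + apply (is_RInt_ext (V := R_NormedModule) (fun _ => 1)).
      { intros t _; rewrite Rmult_0_l, Ropp_0, cos_0; simpl; ring. }
      rewrite <- (Rminus_0_r (2 * PI)) at 2.
      rewrite <- (Rmult_1_r (2 * PI - 0)).
      exact (is_RInt_const (V := R_NormedModule) 0 (2 * PI) 1).
    + apply (is_RInt_ext (V := R_NormedModule) (fun _ => 0)).
      { intros t _; rewrite Rmult_0_l, Ropp_0, sin_0; simpl; ring. }
      assert (I := is_RInt_const (V := R_NormedModule) 0 (2 * PI) 0).
      unfold scal in I; simpl in I; unfold mult in I; simpl in I; now rewrite Rmult_0_r in I.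
  - set (k := INR (S n)); set (c := (/ r) ^ S n).
    assert (Hk : k <> 0) by (unfold k; apply not_0_INR; lia).
    assert (S2 : sin (- (k * (2 * PI))) = 0).
    { rewrite sin_neg; unfold k.
      replace (INR (S n) * (2 * PI)) with (0 + 2 * INR (S n) * PI) by ring.
      rewrite sin_period, sin_0; ring. }
    assert (C2 : cos (- (k * (2 * PI))) = 1).
    { rewrite cos_neg; unfold k.
      replace (INR (S n) * (2 * PI)) with (0 + 2 * INR (S n) * PI) by ring.
      now rewrite cos_period, cos_0. }
    split; simpl fst; simpl snd; unfold polar; simpl fst; simpl snd.
    + replace 0 with (minus (- c / k * sin (- (k * (2 * PI)))) (- c / k * sin (- (k * 0)))) at 2.
      2:{ rewrite S2, !Rmult_0_r, Ropp_0, sin_0, Rmult_0_r; unfold minus, plus, opp; simpl; ring. }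
      apply (is_RInt_derive (V := R_CompleteNormedModule) (fun t => - c / k * sin (- (k * t)))).
      * intros t _; auto_derive; [trivial | field; exact Hk].
      * intros t _; apply (ex_derive_continuous (K := R_AbsRing) (V := R_NormedModule)).
        auto_derive; trivial.
    + replace 0 with (minus (c / k * cos (- (k * (2 * PI)))) (c / k * cos (- (k * 0)))) at 2.
      2:{ rewrite C2, !Rmult_0_r, Ropp_0, cos_0; unfold minus, plus, opp; simpl; ring. }
      apply (is_RInt_derive (V := R_CompleteNormedModule) (fun t => c / k * cos (- (k * t)))).
      * intros t _; auto_derive; [trivial | field; exact Hk].
      * intros t _; apply (ex_derive_continuous (K := R_AbsRing) (V := R_NormedModule)).
        auto_derive; trivial.
Qed.

(** * Taylor expansion on the disc *)

Definition is_Cseries (u : nat -> C) (l : C) : Prop :=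
  is_series (K := C_AbsRing) (V := C_NormedModule) u l.

Lemma is_Cseries_eps (u : nat -> C) (l : C) :
  is_Cseries u l <->
  forall eps, 0 < eps -> exists N, forall n, (N <= n)%nat -> Cmod (sum_n u n - l) < eps.
Proof.
  assert (E := filterlim_locally_ball_norm (U := C_NormedModule) (F := eventually) (sum_n u) l).
  split.
  - intros H eps Heps.
    destruct (proj1 E H (mkposreal eps Heps)) as [N HN].
    exists N; exact HN.
  - intros H; apply (proj2 E); intros eps.
    destruct (H eps (cond_pos eps)) as [N HN]; exists N; exact HN.
Qed.

Lemma fst_sum_n (u : nat -> C) (n : nat) : fst (sum_n u n) = sum_n (fun k => fst (u k)) n.
Proof.
  induction n as [|n IH]; [now rewrite !sum_O|].
  rewrite !sum_Sn, <- IH; reflexivity.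
Qed.

Lemma snd_sum_n (u : nat -> C) (n : nat) : snd (sum_n u n) = sum_n (fun k => snd (u k)) n.
Proof.
  induction n as [|n IH]; [now rewrite !sum_O|].
  rewrite !sum_Sn, <- IH; reflexivity.
Qed.

Lemma is_Cseries_fst (u : nat -> C) (l : C) :
  is_Cseries u l -> is_series (fun n => fst (u n)) (fst l).
Proof.
  intros H; change (is_lim_seq (sum_n (fun n => fst (u n))) (fst l)).
  apply is_lim_seq_spec; intros eps.
  destruct (proj1 (is_Cseries_eps u l) H eps (cond_pos eps)) as [N HN].
  exists N; intros n Hn; eapply Rle_lt_trans; [|exact (HN n Hn)].
  rewrite <- fst_sum_n; exact (re_le_Cmod (sum_n u n - l)).
Qed.

Lemma is_Cseries_snd (u : nat -> C) (l : C) :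
  is_Cseries u l -> is_series (fun n => snd (u n)) (snd l).
Proof.
  intros H; change (is_lim_seq (sum_n (fun n => snd (u n))) (snd l)).
  apply is_lim_seq_spec; intros eps.
  destruct (proj1 (is_Cseries_eps u l) H eps (cond_pos eps)) as [N HN].
  exists N; intros n Hn; eapply Rle_lt_trans; [|exact (HN n Hn)].
  rewrite <- snd_sum_n; exact (im_le_Cmod (sum_n u n - l)).
Qed.

Lemma is_Cseries_unique (u : nat -> C) (l m : C) :
  is_Cseries u l -> is_Cseries u m -> l = m.
Proof.
  intros H1 H2; apply injective_projections.
  - now rewrite <- (is_series_unique _ _ (is_Cseries_fst _ _ H1)),
                <- (is_series_unique _ _ (is_Cseries_fst _ _ H2)).
  - now rewrite <- (is_series_unique _ _ (is_Cseries_snd _ _ H1)),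
                <- (is_series_unique _ _ (is_Cseries_snd _ _ H2)).
Qed.

Lemma is_Cseries_ext (u v : nat -> C) (l : C) :
  (forall n, u n = v n) -> is_Cseries u l -> is_Cseries v l.
Proof. apply (is_series_ext (K := C_AbsRing) (V := C_NormedModule)). Qed.

Lemma is_Cseries_plus (u v : nat -> C) (l m : C) :
  is_Cseries u l -> is_Cseries v m -> is_Cseries (fun n => u n + v n)%C (l + m)%C.
Proof. apply (is_series_plus (K := C_AbsRing) (V := C_NormedModule)). Qed.

Lemma is_Cseries_scal (c : C) (u : nat -> C) (l : C) :
  is_Cseries u l -> is_Cseries (fun n => c * u n)%C (c * l)%C.
Proof. apply (is_series_scal (K := C_AbsRing) (V := C_NormedModule)). Qed.

Lemma is_series_bounded (u : nat -> R) (l : R) :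
  is_series u l -> exists M, forall n, Rabs (u n) <= M.
Proof.
  intros H.
  assert (L : filterlim u eventually (locally 0))
    by exact (ex_series_lim_0 u (ex_intro _ l H)).
  destruct (filterlim_bounded (K := R_AbsRing) (V := R_NormedModule) u (ex_intro _ 0 L)) as [M HM].
  now exists M.
Qed.

Lemma is_Cseries_bounded (u : nat -> C) (l : C) :
  is_Cseries u l -> exists M, forall n, Cmod (u n) <= M.
Proof.
  intros H.
  destruct (is_series_bounded _ _ (is_Cseries_fst _ _ H)) as [M1 H1].
  destruct (is_series_bounded _ _ (is_Cseries_snd _ _ H)) as [M2 H2].
  exists (2 * Rmax M1 M2); intros n.
  rewrite (surjective_pairing (u n)).
  eapply Rle_trans; [apply Cmod_le_2Rmax|].
  apply Rmult_le_compat_l; [lra|].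
  apply Rmax_lub; [eapply Rle_trans; [apply H1 | apply Rmax_l]
                  | eapply Rle_trans; [apply H2 | apply Rmax_r]].
Qed.

Lemma is_Cseries_le (u : nat -> C) (b : nat -> R) (l : C) (s : R) :
  is_Cseries u l -> is_series b s -> (forall n, Cmod (u n) <= b n) -> Cmod l <= s.
Proof.
  intros Hu Hb Hle.
  assert (P : forall n, Cmod (sum_n u n) <= sum_n b n).
  { induction n as [|n IH]; [rewrite !sum_O; apply Hle|].
    rewrite !sum_Sn; eapply Rle_trans; [apply Cmod_triangle|].
    apply Rplus_le_compat; [exact IH | apply Hle]. }
  destruct (Rle_lt_dec (Cmod l) s) as [h|h]; [exact h | exfalso].
  assert (He : 0 < (Cmod l - s) / 2) by lra.
  destruct (proj1 (is_Cseries_eps u l) Hu _ He) as [N1 H1].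
  assert (Hb' : is_lim_seq (sum_n b) s) by exact Hb.
  apply is_lim_seq_spec in Hb'.
  destruct (Hb' (mkposreal _ He)) as [N2 H2]; simpl in H2.
  specialize (H1 (N1 + N2)%nat ltac:(lia)); specialize (H2 (N1 + N2)%nat ltac:(lia)).
  specialize (P (N1 + N2)%nat).
  apply Rabs_lt_between in H2.
  assert (T := Cmod_triangle (sum_n u (N1 + N2)) (- (sum_n u (N1 + N2) - l))).
  rewrite Cmod_opp in T.
  replace (sum_n u (N1 + N2) + - (sum_n u (N1 + N2) - l))%C with l in T
    by (generalize (sum_n u (N1 + N2)); intros; ring).
  lra.
Qed.

Lemma C_cont_const (c z : C) : C_cont (fun _ => c) z.
Proof.
  intros eps Heps; exists 1; split; [lra|]; intros w _.
  replace (c - c)%C with (RtoC 0) by ring; now rewrite Cmod_0.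
Qed.

Lemma C_deriv_const (c z : C) : C_deriv (fun _ => c) z 0.
Proof.
  intros eps Heps; exists 1; split; [lra|]; intros w _.
  replace (c - c - 0 * (w - z))%C with (RtoC 0) by ring; rewrite Cmod_0.
  apply Rmult_le_pos; [lra | apply Cmod_ge_0].
Qed.

Lemma C_geometric_sum (q : C) (N : nat) :
  ((1 - q) * sum_n (fun n => q ^ n)%C N = 1 - q ^ S N)%C.
Proof.
  induction N as [|N IH]; [rewrite sum_O; simpl; ring|].
  rewrite sum_Sn; unfold plus; simpl AbelianMonoid.sort; simpl.
  rewrite Cmult_plus_distr_l, IH; simpl; ring.
Qed.

Lemma C_sum_n_ext (u v : nat -> C) (N : nat) :
  (forall n, u n = v n) -> sum_n u N = sum_n v N :> C.
Proof. exact (sum_n_ext (G := C_AbelianMonoid) u v N). Qed.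

Lemma C_sum_n_scal (c : C) (u : nat -> C) (N : nat) :
  (sum_n (fun n => c * u n) N = c * sum_n u N)%C.
Proof.
  induction N as [|N IH]; [now rewrite !sum_O|].
  rewrite !sum_Sn, IH; unfold plus; simpl; ring.
Qed.

Lemma C_cont_path_bounded (h : R -> C) :
  C_cont_path h -> exists M, forall t, 0 <= t <= 2 * PI -> Cmod (h t) <= M.
Proof.
  intros H.
  destruct (bounded_continuity (K := R_AbsRing) (V := R_NormedModule)
              (fun t => fst (h t)) 0 (2 * PI)) as [M1 H1]; [intros t _; apply H|].
  destruct (bounded_continuity (K := R_AbsRing) (V := R_NormedModule)
              (fun t => snd (h t)) 0 (2 * PI)) as [M2 H2]; [intros t _; apply H|].
  exists (2 * Rmax M1 M2); intros t Ht.
  rewrite (surjective_pairing (h t)).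
  eapply Rle_trans; [apply Cmod_le_2Rmax|].
  apply Rmult_le_compat_l; [lra|].
  apply Rmax_lub.
  - eapply Rle_trans; [left; apply (H1 t Ht) | apply Rmax_l].
  - eapply Rle_trans; [left; apply (H2 t Ht) | apply Rmax_r].
Qed.

(* With q = z / w, F(w) = f w - f z and g(w) = w F(w) / (w - z), the sum
   f(w) (1 + q + ... + q^N) equals f(z) (1 + ... + q^N) + g(w) (1 - q^(N+1)).
   Averaged over |w| = r, the first term gives f(z), the integral of g vanishes
   by the mean value property as g(0) = 0, and the rest is O((|z|/r)^N). *)
Lemma taylor_radius (f : C -> C) (r : R) :
  holo_disc f -> 0 < r < 1 ->
  exists a : nat -> C, forall z, Cmod z < r -> is_Cseries (fun n => a n * z ^ n)%C (f z).
Proof.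
  intros Hf Hr; pose proof PI_RGT_0 as HPI.
  assert (Hd : forall w, Cmod w < 1 -> exists l, C_deriv f w l)
    by (intros w Hw; now apply C_differentiable_deriv, Hf).
  assert (Hc : forall w, Cmod w < 1 -> C_cont f w).
  { intros w Hw; destruct (Hd w Hw) as [l Hl]; exact (C_deriv_cont _ _ _ Hl). }
  assert (Nw : forall t, polar r t <> 0)
    by (intros t; apply Cmod_gt_0; rewrite Cmod_polar; lra).
  assert (pathf : C_cont_path (fun t => f (polar r t))).
  { apply (C_cont_path_polar f); [lra|]; intros w Hw; apply Hc; lra. }
  assert (pathp : forall n, C_cont_path (fun t => (/ polar r t) ^ n)%C).
  { intros n t.
    split.
    - apply (continuous_ext (fun t => (/ r) ^ n * cos (INR n * - t))).
      { intros x; now rewrite polar_inv, polar_pow by lra. }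
      apply (ex_derive_continuous (K := R_AbsRing) (V := R_NormedModule)); auto_derive; trivial.
    - apply (continuous_ext (fun t => (/ r) ^ n * sin (INR n * - t))).
      { intros x; now rewrite polar_inv, polar_pow by lra. }
      apply (ex_derive_continuous (K := R_AbsRing) (V := R_NormedModule)); auto_derive; trivial. }
  (* Cauchy's coefficient formula: on the circle dw / (i w) = dt, so the power is w^(-n) rather than
     w^(-n-1). *)
  set (I := fun n => CInt (fun t => f (polar r t) * (/ polar r t) ^ n)%C).
  assert (HI : forall n, is_CInt (fun t => f (polar r t) * (/ polar r t) ^ n)%C (I n))
    by (intros n; apply CInt_correct, C_cont_path_mult; [exact pathf | apply pathp]).
  exists (fun n => / RtoC (2 * PI) * I n)%C; intros z Hz.
  assert (N2PI : RtoC (2 * PI) <> 0) by (intros E; apply RtoC_inj in E; lra).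
  destruct (Hd z ltac:(lra)) as [l Hl].
  (* Writing w F / (w - z) as F + z F / (w - z) lets [slope] supply the value at w = z. *)
  set (g := fun w => ((f w + - f z) + z * slope f z l w)%C).
  assert (gc : forall w, Cmod w < 1 -> C_cont g w).
  { intros w Hw; unfold g; apply C_cont_plus.
    - apply (C_cont_plus f (fun _ => - f z)%C); [now apply Hc | apply C_cont_const].
    - apply C_cont_scal; destruct (Ceq_dec w z) as [->|Hne]; [now apply slope_cont|].
      destruct (Hd w Hw) as [m Hm].
      destruct (slope_deriv f z l w m Hne Hm) as [k Hk].
      exact (C_deriv_cont _ _ _ Hk). }
  assert (gd : forall w, Cmod w < 1 -> Cmod w <> Cmod z -> exists m, C_deriv g w m).
  { intros w Hw Hwz; assert (Hne : w <> z) by congruence.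
    destruct (Hd w Hw) as [m Hm]; destruct (slope_deriv f z l w m Hne Hm) as [k Hk].
    eexists; unfold g; apply C_deriv_plus.
    - apply (C_deriv_plus f (fun _ => - f z)%C); [exact Hm | apply C_deriv_const].
    - apply C_deriv_scal; exact Hk. }
  assert (g0 : g 0 = 0).
  { unfold g, slope; destruct (Ceq_dec 0 z) as [<-|Hne]; [ring|].
    field; intros E; apply Hne.
    replace z with (- (0 - z))%C by ring; rewrite E; ring. }
  assert (gw : forall t, (f (polar r t) - f z = g (polar r t) * (1 - z * / polar r t))%C).
  { intros t; unfold g, slope; destruct (Ceq_dec (polar r t) z) as [e|Hne].
    - rewrite <- e, Cmod_polar in Hz; lra.
    - assert ((polar r t - z)%C <> 0) by now apply Cminus_eq_contra.
      field; split; [apply Nw | assumption]. }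
  assert (pathg : C_cont_path (fun t => g (polar r t))).
  { apply (C_cont_path_polar g); [lra|]; intros w Hw; apply gc; lra. }
  assert (Ig : is_CInt (fun t => g (polar r t)) 0).
  { assert (E := CInt_correct _ pathg).
    (* The exempted circle passes through [z], the only point where [g] is not known to be
       differentiable. *)
    destruct (mean_value g (Cmod z) gc gd r ltac:(lra)) as [M1 M2].
    unfold CInt in E; rewrite M1, M2, g0 in E; simpl in E.
    rewrite !Rmult_0_r in E; exact E. }
  destruct (C_cont_path_bounded _ pathg) as [M HM].
  assert (HM0 : 0 <= M) by (eapply Rle_trans; [apply Cmod_ge_0 | apply (HM 0); lra]).
  set (q := Cmod z / r).
  assert (Hq : 0 <= q < 1).
  { split; [apply Rdiv_le_0_compat; [apply Cmod_ge_0 | lra]|].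
    apply Rlt_div_l; lra. }
  (* The factor 2 is the 4 pi of [is_CInt_bound] divided by the normalisation 2 pi. *)
  assert (main : forall N,
    Cmod (sum_n (fun n => / RtoC (2 * PI) * I n * z ^ n)%C N - f z) <= 2 * M * q ^ S N).
  { intros N.
    assert (A1 := is_CInt_sum (fun n t => z ^ n * (f (polar r t) * (/ polar r t) ^ n))%C
                    (fun n => z ^ n * I n)%C N (fun n => is_CInt_scal _ _ _ (HI n))).
    assert (A2 := is_CInt_sum (fun n t => z ^ n * (/ polar r t) ^ n)%C _ N
                    (fun n => is_CInt_scal (z ^ n) _ _ (is_CInt_inv_pow r n (proj1 Hr)))).
    assert (E2 : sum_n (fun n => z ^ n * (if n then RtoC (2 * PI) else RtoC 0))%C N
                 = RtoC (2 * PI)).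
    { clear; induction N as [|N IH]; [rewrite sum_O; simpl; ring|].
      rewrite sum_Sn, IH; unfold plus; simpl; ring. }
    rewrite E2 in A2.
    assert (pathR : C_cont_path (fun t => g (polar r t) * (/ polar r t) ^ S N)%C)
      by (apply C_cont_path_mult; [exact pathg | apply pathp]).
    assert (A3 := is_CInt_scal (z ^ S N) _ _ (CInt_correct _ pathR)).
    set (Rm := (z ^ S N * CInt (fun t => g (polar r t) * (/ polar r t) ^ S N))%C) in *.
    assert (bR : Cmod Rm <= 4 * PI * (M * q ^ S N)).
    { apply (is_CInt_bound _ _ _ A3); intros t Ht.
      rewrite !Cmod_mult, !Cmod_pow, Cmod_inv, Cmod_polar by (try apply Nw; lra).
      unfold q, Rdiv; rewrite Rpow_mult_distr.
      specialize (HM t Ht).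
      assert (0 <= Cmod z ^ S N) by (apply pow_le, Cmod_ge_0).
      assert (0 <= (/ r) ^ S N)
        by (apply pow_le; left; apply Rinv_0_lt_compat; lra).
      replace (Cmod z ^ S N * (Cmod (g (polar r t)) * (/ r) ^ S N))
        with (Cmod (g (polar r t)) * (Cmod z ^ S N * (/ r) ^ S N)) by ring.
      apply Rmult_le_compat_r; [now apply Rmult_le_pos | exact HM]. }
    (* A second evaluation of the integral in [A1], through the geometric sum: [A2] supplies f(z),
       as only n = 0 survives there, [Ig] supplies 0 and [A3] the remainder. *)
    assert (B : is_CInt
      (fun t => sum_n (fun n => z ^ n * (f (polar r t) * (/ polar r t) ^ n))%C N)
      (f z * RtoC (2 * PI) + (0 + (- (1)) * Rm))%C).
    { refine (is_CInt_ext _ _ _ _ (is_CInt_plus _ _ _ _ (is_CInt_scal (f z) _ _ A2)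
                (is_CInt_plus _ _ _ _ Ig (is_CInt_scal (- (1)) _ _ A3)))).
      intros t; set (w := polar r t).
      assert (S1 : sum_n (fun n => z ^ n * (/ w) ^ n)%C N
                   = sum_n (fun n => (z * / w) ^ n)%C N)
        by (apply C_sum_n_ext; intros n; now rewrite Cpow_mult_l).
      assert (S2 : sum_n (fun n => z ^ n * (f w * (/ w) ^ n))%C N
                   = (f w * sum_n (fun n => (z * / w) ^ n) N)%C).
      { rewrite <- C_sum_n_scal; apply C_sum_n_ext; intros n; rewrite Cpow_mult_l; ring. }
      rewrite S1, S2.
      assert (Fw : (f w = f z + g w * (1 - z * / w))%C)
        by (unfold w; rewrite <- gw; ring).
      rewrite Fw.
      rewrite Cmult_plus_distr_r, <- Cmult_assoc, C_geometric_sum, Cpow_mult_l; ring. }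
    assert (EQ := is_CInt_unique _ _ _ A1 B).
    assert (SE : sum_n (fun n => / RtoC (2 * PI) * I n * z ^ n)%C N
                 = (/ RtoC (2 * PI) * sum_n (fun n => z ^ n * I n) N)%C).
    { rewrite <- C_sum_n_scal; apply C_sum_n_ext; intros n; ring. }
    rewrite SE, EQ.
    replace (/ RtoC (2 * PI) * (f z * RtoC (2 * PI) + (0 + - (1) * Rm)) - f z)%C
      with (- (/ RtoC (2 * PI) * Rm))%C by (field; exact N2PI).
    rewrite Cmod_opp, Cmod_mult, Cmod_inv, Cmod_R, Rabs_pos_eq by (try exact N2PI; lra).
    apply (Rmult_le_reg_l (2 * PI)); [lra|].
    rewrite <- Rmult_assoc, Rinv_r, Rmult_1_l by lra; lra. }
  apply is_Cseries_eps; intros eps Heps.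
  destruct (pow_lt_1_zero q ltac:(rewrite Rabs_pos_eq; lra) (eps / (2 * M + 1))) as [N HN].
  { apply Rdiv_lt_0_compat; lra. }
  exists N; intros n Hn.
  eapply Rle_lt_trans; [apply main|].
  specialize (HN (S n) ltac:(lia)).
  rewrite Rabs_pos_eq in HN by (apply pow_le; lra).
  assert (E : eps / (2 * M + 1) * (2 * M + 1) = eps) by (field; lra).
  assert (0 <= q ^ S n) by (apply pow_le; lra).
  nra.
Qed.

(** * Uniqueness of coefficients and passage to the whole disc *)

Lemma Cpow_RtoC (x : R) (n : nat) : (RtoC x ^ n)%C = RtoC (x ^ n).
Proof. symmetry; apply RtoC_pow. Qed.

Lemma PSeries_coef_unique (a b : nat -> R) (r : R) (s : R -> R) :
  0 < r ->
  (forall x, Rabs x < r -> is_series (fun n => a n * x ^ n) (s x)) ->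
  (forall x, Rabs x < r -> is_series (fun n => b n * x ^ n) (s x)) ->
  forall n, a n = b n.
Proof.
  intros Hr Ha Hb n.
  assert (CV : forall c, (forall x, Rabs x < r -> is_series (fun n => c n * x ^ n) (s x)) ->
               Rbar_lt 0 (CV_radius c)).
  { intros c Hc.
    assert (B : exists M, forall n, Rabs (c n * (r / 2) ^ n) <= M).
    { apply (is_series_bounded _ (s (r / 2))), Hc; rewrite Rabs_pos_eq; lra. }
    destruct (CV_radius_bounded c) as [ub _].
    apply (Rbar_lt_le_trans 0 (r / 2)); [simpl; lra | now apply ub]. }
  apply PSeries_ext_recip; [now apply CV | now apply CV |].
  exists (mkposreal r Hr); intros x Hx.
  assert (Hx' : Rabs x < r).
  { replace x with (minus x 0) by (unfold minus, plus, opp; simpl; ring); exact Hx. }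
  unfold PSeries.
  now rewrite (is_series_unique _ _ (Ha x Hx')), (is_series_unique _ _ (Hb x Hx')).
Qed.

(** On the real axis the series splits into two real power series, whose coefficients are the real
    and imaginary parts. *)
Lemma Cseries_coef_unique (a b : nat -> C) (r : R) (f : C -> C) :
  0 < r ->
  (forall z, Cmod z < r -> is_Cseries (fun n => a n * z ^ n)%C (f z)) ->
  (forall z, Cmod z < r -> is_Cseries (fun n => b n * z ^ n)%C (f z)) ->
  forall n, a n = b n.
Proof.
  intros Hr Ha Hb n.
  assert (K : forall c, (forall z, Cmod z < r -> is_Cseries (fun n => c n * z ^ n)%C (f z)) ->
    forall x, Rabs x < r -> is_series (fun n => fst (c n) * x ^ n) (fst (f (RtoC x))) /\
                            is_series (fun n => snd (c n) * x ^ n) (snd (f (RtoC x)))).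
  { intros c Hc x Hx.
    rewrite <- Cmod_R in Hx; specialize (Hc _ Hx); split.
    - eapply is_series_ext; [|apply is_Cseries_fst; exact Hc].
      intros k; simpl; rewrite Cpow_RtoC; simpl; ring.
    - eapply is_series_ext; [|apply is_Cseries_snd; exact Hc].
      intros k; simpl; rewrite Cpow_RtoC; simpl; ring. }
  apply injective_projections.
  - apply (PSeries_coef_unique (fun n => fst (a n)) (fun n => fst (b n)) r
             (fun x => fst (f (RtoC x)))); try assumption; intros x Hx; now apply K.
  - apply (PSeries_coef_unique (fun n => snd (a n)) (fun n => snd (b n)) r
             (fun x => snd (f (RtoC x)))); try assumption; intros x Hx; now apply K.
Qed.

(** The coefficients found on radius 1/2 serve everywhere: those of any larger radius represent the
    same function on |w| < 1/2, so they coincide with them. *)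
Lemma taylor_disc (f : C -> C) :
  holo_disc f ->
  exists a : nat -> C, forall z, in_disc z -> is_Cseries (fun n => a n * z ^ n)%C (f z).
Proof.
  intros Hf.
  destruct (taylor_radius f (1 / 2) Hf ltac:(lra)) as [a Ha].
  exists a; intros z Hz; unfold in_disc in Hz.
  set (r := (1 + Rmax (Cmod z) (1 / 2)) / 2).
  assert (Hr : Rmax (Cmod z) (1 / 2) < 1) by (apply Rmax_case; lra).
  pose proof (Rmax_l (Cmod z) (1 / 2)); pose proof (Rmax_r (Cmod z) (1 / 2)).
  destruct (taylor_radius f r Hf ltac:(unfold r; lra)) as [b Hb].
  apply (is_Cseries_ext (fun n => b n * z ^ n)%C); [|apply Hb; unfold r; lra].
  intros n; f_equal; symmetry.
  apply (Cseries_coef_unique a b (1 / 2) f); [lra | exact Ha |].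
  intros w Hw; apply Hb; unfold r; lra.
Qed.

(** * Power series of radius at least one *)

(* For coefficients of a power series: radius of convergence at least 1. *)
Definition tame (c : nat -> R) : Prop :=
  forall r, 0 < r < 1 -> exists M, forall n, Rabs (c n) * r ^ n <= M.

Lemma tame_le (c d : nat -> R) (K : R) :
  (forall n, Rabs (d n) <= K * Rabs (c n)) -> tame c -> tame d.
Proof.
  intros H Hc r Hr; destruct (Hc r Hr) as [M HM].
  assert (HK : forall n, 0 <= r ^ n) by (intros n; apply pow_le; lra).
  exists (Rmax 0 K * M); intros n.
  apply Rle_trans with (Rmax 0 K * (Rabs (c n) * r ^ n)).
  - rewrite <- Rmult_assoc; apply Rmult_le_compat_r; [apply HK|].
    eapply Rle_trans; [apply H|]; apply Rmult_le_compat_r; [apply Rabs_pos | apply Rmax_r].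
  - apply Rmult_le_compat_l; [apply Rmax_l | apply HM].
Qed.

(** Bernoulli's inequality (1 + x)^n >= 1 + n x with 1 + x = 1 / s gives n s^n <= 1 / x. *)
Lemma linear_geometric_bounded (s : R) :
  0 < s < 1 -> exists M, forall n, (INR n + 1) * s ^ n <= M.
Proof.
  intros Hs.
  set (x := / s - 1).
  assert (Hx : 0 < x).
  { unfold x; apply Rlt_0_minus; rewrite <- Rinv_1; apply Rinv_lt_contravar; lra. }
  exists (1 + / x); intros n.
  assert (B := poly n x Hx).
  replace (1 + x) with (/ s) in B by (unfold x; ring).
  rewrite pow_inv in B.
  assert (P : 0 < s ^ n) by (apply pow_lt; lra).
  apply (Rmult_le_compat_r (s ^ n)) in B; [|lra].
  rewrite Rinv_l in B by lra.
  assert (P1 : s ^ n <= 1) by (rewrite <- (pow1 n); apply pow_incr; lra).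
  assert (INR n * s ^ n <= / x).
  { apply (Rmult_le_reg_l x); [exact Hx|]; rewrite Rinv_r by lra; nra. }
  lra.
Qed.

(** Boundedness at a radius r' strictly between r and 1 leaves a spare factor (r / r')^n, which
    absorbs n + 1. *)
Lemma tame_mul_linear (c : nat -> R) : tame c -> tame (fun n => (INR n + 1) * c n).
Proof.
  intros Hc r Hr.
  set (r' := (1 + r) / 2).
  assert (Hr' : r < r' < 1) by (unfold r'; lra).
  destruct (Hc r' ltac:(lra)) as [M HM].
  destruct (linear_geometric_bounded (r / r')) as [M' HM'].
  { split; [apply Rdiv_lt_0_compat; lra | apply Rlt_div_l; lra]. }
  exists (M * M'); intros n.
  assert (0 <= INR n) by apply pos_INR.
  rewrite Rabs_mult, (Rabs_pos_eq (INR n + 1)) by lra.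
  replace ((INR n + 1) * Rabs (c n) * r ^ n)
    with ((Rabs (c n) * r' ^ n) * ((INR n + 1) * (r / r') ^ n)).
  2:{ unfold Rdiv; rewrite Rpow_mult_distr, pow_inv; field; apply pow_nonzero; lra. }
  apply Rmult_le_compat; [| | apply HM | apply HM'].
  - apply Rmult_le_pos; [apply Rabs_pos | apply pow_le; lra].
  - apply Rmult_le_pos; [lra | apply pow_le, Rdiv_le_0_compat; lra].
Qed.

(** Serves twice: for the inverses of small divisors, and for the n^2 lost in termwise
    differentiation. *)
Lemma tame_mul_poly (m : nat) (c : nat -> R) :
  tame c -> tame (fun n => (INR n + 1) ^ m * c n).
Proof.
  intros Hc; induction m as [|m IH].
  - apply (tame_le c _ 1); [|exact Hc]; intros n; simpl; rewrite Rmult_1_l; lra.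
  - apply (tame_le _ _ 1) with (2 := tame_mul_linear _ IH); intros n; simpl.
    rewrite <- Rmult_assoc; lra.
Qed.

Lemma tame_summable (c : nat -> R) (r : R) :
  tame c -> 0 < r < 1 -> ex_series (fun n => Rabs (c n) * r ^ n).
Proof.
  intros Hc Hr.
  set (r' := (1 + r) / 2).
  assert (Hr' : r < r' < 1) by (unfold r'; lra).
  destruct (Hc r' ltac:(lra)) as [M HM].
  assert (Hq : 0 <= r / r' < 1).
  { split; [apply Rdiv_le_0_compat; lra | apply Rlt_div_l; lra]. }
  apply (ex_series_le (V := R_CompleteNormedModule) _ (fun n => M * (r / r') ^ n)).
  - intros n.
    change (Rabs (Rabs (c n) * r ^ n) <= M * (r / r') ^ n).
    rewrite Rabs_pos_eq by (apply Rmult_le_pos; [apply Rabs_pos | apply pow_le; lra]).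
    replace (Rabs (c n) * r ^ n) with (Rabs (c n) * r' ^ n * (r / r') ^ n).
    2:{ unfold Rdiv; rewrite Rpow_mult_distr, pow_inv; field; apply pow_nonzero; lra. }
    apply Rmult_le_compat_r; [apply pow_le; lra | apply HM].
  - apply (ex_series_scal (V := R_NormedModule) M (fun n => (r / r') ^ n)), ex_series_geom; rewrite Rabs_pos_eq; lra.
Qed.

Lemma Cseries_tame (a : nat -> C) (f : C -> C) :
  (forall z, in_disc z -> is_Cseries (fun n => a n * z ^ n)%C (f z)) ->
  tame (fun n => Cmod (a n)).
Proof.
  intros H r Hr.
  assert (Hd : in_disc (RtoC r)) by (unfold in_disc; rewrite Cmod_R, Rabs_pos_eq; lra).
  destruct (is_Cseries_bounded _ _ (H _ Hd)) as [M HM]; exists M; intros n.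
  specialize (HM n); rewrite Cmod_mult, Cmod_pow, Cmod_R, (Rabs_pos_eq r) in HM by lra.
  now rewrite Rabs_pos_eq by apply Cmod_ge_0.
Qed.

Lemma ex_Cseries_le (u : nat -> C) (b : nat -> R) :
  (forall n, Cmod (u n) <= b n) -> ex_series b -> exists l, is_Cseries u l.
Proof. apply (ex_series_le (K := C_AbsRing) (V := C_CompleteNormedModule)). Qed.

Definition pow_derivative (z : C) (n : nat) : C :=
  match n with O => RtoC 0 | S m => (RtoC (INR n) * z ^ m)%C end.

(** The factor [rho] on the left replaces the exponent n - 1 on the right, which would need a
    separate case at n = 0. *)
Lemma pow_derivative_bound (z : C) (rho : R) (n : nat) :
  Cmod z <= rho -> Cmod (pow_derivative z n) * rho <= INR n * rho ^ n.
Proof.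
  intros Hz; pose proof (Cmod_ge_0 z).
  destruct n as [|n]; [simpl; rewrite Cmod_0; lra|].
  unfold pow_derivative; rewrite Cmod_mult, Cmod_pow, Cmod_R, Rabs_pos_eq by apply pos_INR.
  rewrite Rmult_assoc; apply Rmult_le_compat_l; [apply pos_INR|].
  simpl; rewrite Rmult_comm; apply Rmult_le_compat_l; [lra | now apply pow_incr].
Qed.

Lemma pow_derivative_S (z : C) (n : nat) : pow_derivative z (S n) = (z ^ n + z * pow_derivative z n)%C.
Proof.
  unfold pow_derivative; rewrite S_INR, RtoC_plus; destruct n as [|n].
  - simpl; ring.
  - rewrite (Cpow_S z n); ring.
Qed.

(** If E_n is the second-order remainder of the n-th power, then E_(n+1) = w E_n + n z^(n-1) (w -
    z)^2. The induction closes because n^2 + n <= (n + 1)^2. *)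
Lemma pow_taylor_bound (z w : C) (rho : R) (n : nat) :
  0 < rho -> Cmod z <= rho -> Cmod w <= rho ->
  Cmod (w ^ n - z ^ n - pow_derivative z n * (w - z)) * rho ^ 2
    <= INR n ^ 2 * rho ^ n * Cmod (w - z) ^ 2.
Proof.
  intros Hrho Hz Hw; induction n as [|n IH].
  - simpl; replace (1 - 1 - 0 * (w - z))%C with (RtoC 0) by ring; rewrite Cmod_0; lra.
  - rewrite pow_derivative_S.
    replace (w ^ S n - z ^ S n - (z ^ n + z * pow_derivative z n) * (w - z))%C
      with (w * (w ^ n - z ^ n - pow_derivative z n * (w - z)) + pow_derivative z n * (w - z) * (w - z))%C
      by (rewrite !Cpow_S; ring).
    set (E := (w ^ n - z ^ n - pow_derivative z n * (w - z))%C) in *.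
    assert (D := pow_derivative_bound z rho n Hz).
    eapply Rle_trans; [apply Rmult_le_compat_r; [apply pow2_ge_0 | apply Cmod_triangle]|].
    rewrite !Cmod_mult.
    set (d := Cmod (w - z)) in *.
    pose proof (Cmod_ge_0 E); pose proof (Cmod_ge_0 w); pose proof (pos_INR n).
    assert (P : 0 < rho ^ n) by now apply pow_lt.
    pose proof (pow2_ge_0 d).
    assert (A1 : Cmod w * Cmod E * rho ^ 2 <= rho * (INR n ^ 2 * rho ^ n * d ^ 2)).
    { rewrite Rmult_assoc; apply Rmult_le_compat; [assumption | | assumption | exact IH].
      apply Rmult_le_pos; [assumption | apply pow2_ge_0]. }
    assert (A2 : Cmod (pow_derivative z n) * d * d * rho ^ 2 <= INR n * rho ^ n * rho * d ^ 2).
    { replace (Cmod (pow_derivative z n) * d * d * rho ^ 2)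
        with (Cmod (pow_derivative z n) * rho * (rho * d ^ 2)) by ring.
      replace (INR n * rho ^ n * rho * d ^ 2)
        with (INR n * rho ^ n * (rho * d ^ 2)) by ring.
      apply Rmult_le_compat_r; [apply Rmult_le_pos; lra | exact D]. }
    rewrite S_INR.
    replace (rho ^ S n) with (rho ^ n * rho) by (simpl; ring).
    assert (A3 : 0 <= (INR n + 1) * (rho ^ n * rho * d ^ 2)).
    { apply Rmult_le_pos; [lra|]; apply Rmult_le_pos; [apply Rmult_le_pos; lra | assumption]. }
    replace ((INR n + 1) ^ 2 * (rho ^ n * rho) * d ^ 2)
      with (rho * (INR n ^ 2 * rho ^ n * d ^ 2) + INR n * rho ^ n * rho * d ^ 2
            + (INR n + 1) * (rho ^ n * rho * d ^ 2)) by ring.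
    lra.
Qed.

(** Termwise differentiation: summing [pow_taylor_bound] against the coefficients bounds the
    remainder by k |w - z|^2, locally uniformly. *)
Lemma tame_series_holo (a : nat -> C) (f : C -> C) :
  tame (fun n => Cmod (a n)) ->
  (forall z, in_disc z -> is_Cseries (fun n => a n * z ^ n)%C (f z)) ->
  holo_disc f.
Proof.
  intros Ha Hf z Hz; apply C_differentiable_deriv.
  unfold in_disc in Hz; pose proof (Cmod_ge_0 z).
  set (rho := (1 + Cmod z) / 2).
  assert (Hrho : Cmod z < rho < 1) by (unfold rho; lra).
  assert (Hrho0 : 0 < rho) by lra.
  (* One majorant for three series, up to powers of [rho]: the function, its formal derivative and
     the second-order remainder. *)
  set (B := fun n => Rabs ((INR n + 1) ^ 2 * Cmod (a n)) * rho ^ n).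
  assert (HB : forall n, (INR n + 1) ^ 2 * Cmod (a n) * rho ^ n = B n).
  { intros n; unfold B; rewrite Rabs_pos_eq; [reflexivity|].
    apply Rmult_le_pos; [apply pow2_ge_0 | apply Cmod_ge_0]. }
  assert (exB : ex_series B) by (apply tame_summable; [now apply tame_mul_poly | lra]).
  assert (posn : forall n, 0 <= Cmod (a n) * rho ^ n)
    by (intros n; apply Rmult_le_pos; [apply Cmod_ge_0 | apply pow_le; lra]).
  assert (exL : exists l, is_Cseries (fun n => a n * pow_derivative z n)%C l).
  { apply (ex_Cseries_le _ (fun n => / rho * B n)); [|now apply (ex_series_scal (V := R_NormedModule) (/ rho) B)].
    intros n; apply (Rmult_le_reg_r rho); [lra|].
    replace (/ rho * B n * rho) with (B n) by (field; lra).
    rewrite Cmod_mult, Rmult_assoc, <- HB.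
    pose proof (pos_INR n); pose proof (posn n).
    apply Rle_trans with (Cmod (a n) * (INR n * rho ^ n)).
    - apply Rmult_le_compat_l; [apply Cmod_ge_0 | apply pow_derivative_bound; lra].
    - nra. }
  destruct exL as [l Hl]; destruct exB as [K HK].
  exists l; intros eps Heps.
  assert (HK0 : 0 <= K).
  { eapply Rle_trans; [apply Cmod_ge_0|].
    apply (is_Cseries_le (fun n => a n * z ^ n)%C B (f z) K); [now apply Hf | exact HK |].
    intros n; rewrite Cmod_mult, Cmod_pow, <- HB.
    pose proof (pos_INR n); pose proof (posn n).
    apply Rle_trans with (Cmod (a n) * rho ^ n); [|nra].
    apply Rmult_le_compat_l; [apply Cmod_ge_0 | apply pow_incr; lra]. }
  set (k := / rho ^ 2 * K).
  assert (Hrho2 : 0 < rho ^ 2) by (apply pow_lt; lra).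
  assert (Hk : 0 <= k) by (apply Rmult_le_pos; [left; now apply Rinv_0_lt_compat | exact HK0]).
  exists (Rmin (rho - Cmod z) (eps / (k + 1))); split.
  { apply Rmin_case; [lra | apply Rdiv_lt_0_compat; lra]. }
  intros w Hw.
  assert (h1 := Rlt_le_trans _ _ _ Hw (Rmin_l _ _)).
  assert (h2 := Rlt_le_trans _ _ _ Hw (Rmin_r _ _)); clear Hw.
  assert (Hw : Cmod w <= rho).
  { replace w with (z + (w - z))%C by ring.
    eapply Rle_trans; [apply Cmod_triangle | lra]. }
  assert (Q : Cmod (f w - f z - l * (w - z)) <= k * Cmod (w - z) ^ 2).
  { apply (is_Cseries_le (fun n => a n * (w ^ n - z ^ n - pow_derivative z n * (w - z)))%C
             (fun n => / rho ^ 2 * Cmod (w - z) ^ 2 * B n)).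
    - assert (S1 := is_Cseries_plus _ _ _ _ (Hf w ltac:(unfold in_disc; lra))
               (is_Cseries_plus _ _ _ _ (is_Cseries_scal (- (1)) _ _ (Hf z Hz))
                  (is_Cseries_scal (- (w - z)) _ _ Hl))).
      replace (f w - f z - l * (w - z))%C
        with (f w + (- (1) * f z + - (w - z) * l))%C by ring.
      refine (is_Cseries_ext _ _ _ _ S1); intros n; simpl; ring.
    - unfold k; replace (/ rho ^ 2 * K * Cmod (w - z) ^ 2)
        with (scal (/ rho ^ 2 * Cmod (w - z) ^ 2) K)
        by (unfold scal; simpl; unfold mult; simpl; ring).
      now apply (is_series_scal (V := R_NormedModule)).
    - intros n; rewrite Cmod_mult, <- HB.
      apply (Rmult_le_reg_r (rho ^ 2)); [exact Hrho2|].
      rewrite Rmult_assoc.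
      eapply Rle_trans.
      { apply Rmult_le_compat_l; [apply Cmod_ge_0|].
        apply (pow_taylor_bound z w rho n); lra. }
      pose proof (pos_INR n); pose proof (posn n); pose proof (pow2_ge_0 (Cmod (w - z))).
      replace (/ rho ^ 2 * Cmod (w - z) ^ 2 * ((INR n + 1) ^ 2 * Cmod (a n) * rho ^ n) * rho ^ 2)
        with ((INR n + 1) ^ 2 * (Cmod (a n) * rho ^ n * Cmod (w - z) ^ 2)) by (field; lra).
      replace (Cmod (a n) * (INR n ^ 2 * rho ^ n * Cmod (w - z) ^ 2))
        with (INR n ^ 2 * (Cmod (a n) * rho ^ n * Cmod (w - z) ^ 2)) by ring.
      apply Rmult_le_compat_r; [now apply Rmult_le_pos | nra]. }
  eapply Rle_trans; [exact Q|].
  pose proof (Cmod_ge_0 (w - z)).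
  assert (E : eps / (k + 1) * (k + 1) = eps) by (field; lra).
  replace (k * Cmod (w - z) ^ 2) with (k * Cmod (w - z) * Cmod (w - z)) by ring.
  apply Rmult_le_compat_r; [assumption | nra].
Qed.

(** [Series] is total, so taking it on each component yields a function on all of [C] without
    choosing limits. *)
Lemma tame_series_exists (a : nat -> C) :
  tame (fun n => Cmod (a n)) ->
  exists f : C -> C, forall z, in_disc z -> is_Cseries (fun n => a n * z ^ n)%C (f z).
Proof.
  intros Ha.
  exists (fun z => (Series (fun n => fst (a n * z ^ n)%C), Series (fun n => snd (a n * z ^ n)%C))).
  intros z Hz; unfold in_disc in Hz; pose proof (Cmod_ge_0 z).
  destruct (ex_Cseries_le (fun n => a n * z ^ n)%C
              (fun n => Rabs (Cmod (a n)) * ((1 + Cmod z) / 2) ^ n)) as [l Hl].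
  - intros n; rewrite Cmod_mult, Cmod_pow, Rabs_pos_eq by apply Cmod_ge_0.
    apply Rmult_le_compat_l; [apply Cmod_ge_0 | apply pow_incr; lra].
  - apply tame_summable; [exact Ha | lra].
  - rewrite (is_series_unique _ _ (is_Cseries_fst _ _ Hl)),
            (is_series_unique _ _ (is_Cseries_snd _ _ Hl)), <- surjective_pairing.
    exact Hl.
Qed.

(** * Small divisors and the spectrum *)

Lemma e2ipi_polar (x : R) : e2ipi x = polar 1 (2 * PI * x).
Proof. unfold e2ipi, polar; f_equal; ring. Qed.

Lemma e2ipi_pow (x : R) (n : nat) : (e2ipi x ^ n)%C = e2ipi (INR n * x).
Proof. rewrite !e2ipi_polar, polar_pow, pow1; f_equal; ring. Qed.

Lemma Cmod_e2ipi (x : R) : Cmod (e2ipi x) = 1.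
Proof. rewrite e2ipi_polar; apply Cmod_polar; lra. Qed.

Lemma e2ipi_period (x : R) (k : Z) : e2ipi (x + IZR k) = e2ipi x.
Proof.
  assert (nat_case : forall y n, e2ipi (y + INR n) = e2ipi y).
  { intros y n; unfold e2ipi.
    replace (2 * PI * (y + INR n)) with (2 * PI * y + 2 * INR n * PI) by ring.
    now rewrite cos_period, sin_period. }
  destruct (Z_le_gt_dec 0 k) as [h|h].
  - rewrite <- (Z2Nat.id k), <- INR_IZR_INZ by exact h; apply nat_case.
  - rewrite <- (nat_case (x + IZR k) (Z.to_nat (- k))).
    rewrite INR_IZR_INZ, Z2Nat.id, opp_IZR by lia; f_equal; ring.
Qed.

(** The length of a chord, from 2 - 2 cos u = 4 sin^2 (u / 2). *)
Lemma Cmod_e2ipi_minus (x y : R) :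
  Cmod (e2ipi x - e2ipi y) = 2 * Rabs (sin (PI * (x - y))).
Proof.
  rewrite <- (Rabs_pos_eq 2) at 1 by lra.
  rewrite <- Rabs_mult, <- sqrt_Rsqr_abs; unfold Cmod; f_equal.
  unfold e2ipi, Cminus, Cplus, Copp; simpl fst; simpl snd.
  assert (E := cos_2a_sin (PI * (x - y))).
  replace (2 * (PI * (x - y))) with (2 * PI * x - 2 * PI * y) in E by ring.
  rewrite cos_minus in E.
  assert (E1 := sin2_cos2 (2 * PI * x)); assert (E2 := sin2_cos2 (2 * PI * y)).
  unfold Rsqr in *; lra.
Qed.

(** For 0 <= y <= 2, sin y >= y - y^3 / 6 >= y / 3 because y^2 <= 4; with y = pi v and pi > 3 this
    is at least v. *)
Lemma sin_PI_lower_bound (v : R) : Rabs v <= 1 / 2 -> Rabs v <= Rabs (sin (PI * v)).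
Proof.
  assert (pos : forall v, 0 <= v <= 1 / 2 -> v <= sin (PI * v)).
  { clear v; intros v Hv.
    assert (P3 : 3 < PI) by (pose proof PI2_3_2; lra).
    pose proof PI_4.
    assert (Hy : 0 <= PI * v <= 2) by nra.
    destruct (pre_sin_bound (PI * v) 0) as [B _]; [lra | lra |].
    unfold sin_approx, sin_term in B; simpl in B.
    set (y := PI * v) in *.
    assert (B' : y - y ^ 3 / 6 <= sin y).
    { eapply Rle_trans; [|exact B]; right; simpl; field. }
    assert (y ^ 3 <= 4 * y) by (simpl; nra).
    assert (3 * v <= y) by (unfold y; nra).
    lra. }
  intros Hv; destruct (Rle_lt_dec 0 v) as [h|h].
  - rewrite (Rabs_pos_eq v) in * by exact h.
    eapply Rle_trans; [now apply pos | apply Rle_abs].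
  - rewrite (Rabs_left v) in * by exact h.
    rewrite <- (Rabs_Ropp (sin _)), <- sin_neg.
    replace (- (PI * v)) with (PI * - v) by ring.
    eapply Rle_trans; [apply (pos (- v)); lra | apply Rle_abs].
Qed.

Lemma e2ipi_dist_nearest_int (x y : R) :
  exists k : Z, 2 * Rabs (x - y - IZR k) <= Cmod (e2ipi x - e2ipi y).
Proof.
  (* [up] exceeds its argument by at most 1, so the shift by 1/2 makes [k] a nearest integer to x -
     y. *)
  exists (up (x - y - 1 / 2)); set (k := up _).
  destruct (archimed (x - y - 1 / 2)) as [K1 K2]; fold k in K1, K2.
  rewrite <- (e2ipi_period y k), Cmod_e2ipi_minus.
  replace (x - (y + IZR k)) with (x - y - IZR k) by ring.
  apply Rmult_le_compat_l; [lra|]; apply sin_PI_lower_bound, Rabs_le; lra.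
Qed.

Lemma e2ipi_surj (lam : C) : Cmod lam = 1 -> exists x, lam = e2ipi x.
Proof.
  destruct lam as [a b]; intros H.
  assert (S : a * a + b * b = 1).
  { unfold Cmod in H; simpl in H.
    rewrite <- (sqrt_sqrt (a * a + b * b)) by nra.
    replace (a * (a * 1) + b * (b * 1)) with (a * a + b * b) in H by ring.
    rewrite H; ring. }
  assert (Ha : -1 <= a <= 1) by nra.
  pose proof PI_RGT_0.
  assert (E : sqrt (1 - Rsqr a) = Rabs b).
  { rewrite <- sqrt_Rsqr_abs; f_equal; unfold Rsqr; lra. }
  destruct (Rle_lt_dec 0 b) as [h|h].
  - exists (acos a / (2 * PI)); unfold e2ipi.
    replace (2 * PI * (acos a / (2 * PI))) with (acos a) by (field; lra).
    rewrite cos_acos, sin_acos, E, Rabs_pos_eq by assumption; reflexivity.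
  - exists (- acos a / (2 * PI)); unfold e2ipi.
    replace (2 * PI * (- acos a / (2 * PI))) with (- acos a) by (field; lra).
    rewrite cos_neg, sin_neg, cos_acos, sin_acos, E, Rabs_left by assumption.
    f_equal; ring.
Qed.

(** Since q >= 1, a larger exponent only weakens the bound; a natural one allows [pow] in place of
    [Rpower]. *)
Lemma diophantine_nat_exponent (tau xi : R) :
  diophantine tau xi ->
  exists gamma m, 0 < gamma /\ forall (p : Z) (q : nat), (0 < q)%nat ->
    gamma <= INR q ^ m * Rabs (IZR p / INR q - xi).
Proof.
  intros (gamma & Hg & H).
  destruct (INR_unbounded tau) as [m Hm].
  exists gamma, m; split; [lra|]; intros p q Hq.
  assert (Hq1 : 1 <= INR q) by (apply (le_INR 1); lia).
  specialize (H p q Hq).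
  assert (B : Rpower (INR q) tau <= INR q ^ m).
  { rewrite <- Rpower_pow by lra; apply Rle_Rpower; lra. }
  rewrite Rpower_Ropp in H.
  assert (P : 0 < Rpower (INR q) tau) by apply exp_pos.
  apply Rle_trans with (Rpower (INR q) tau * Rabs (IZR p / INR q - xi)).
  - apply Rge_le, (Rmult_le_compat_l (Rpower (INR q) tau)) in H; [|lra].
    replace (Rpower (INR q) tau * (gamma * / Rpower (INR q) tau)) with gamma in H
      by (field; lra).
    exact H.
  - apply Rmult_le_compat_r; [apply Rabs_pos | exact B].
Qed.

(** The weight n + 1 instead of n keeps the condition meaningful at n = 0, where it says that [lam]
    is not 1 whenever m > 0 as well. *)
Definition poly_separated (lam beta : C) : Prop :=
  exists c m, 0 < c /\ forall n, c <= (INR n + 1) ^ m * Cmod (lam - beta ^ n).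

Lemma poly_separated_root_of_unity (tau xi : R) (p : Z) (q : nat) :
  diophantine tau xi -> (0 < q)%nat -> e2ipi (IZR p / INR q) <> 1 ->
  poly_separated (e2ipi (IZR p / INR q)) (e2ipi xi).
Proof.
  intros Hxi Hq Hne.
  destruct (diophantine_nat_exponent tau xi Hxi) as (gamma & m & Hg & H).
  set (lam := e2ipi (IZR p / INR q)) in *.
  assert (Hq0 : 0 < INR q) by now apply lt_0_INR.
  assert (Hqm : 0 < INR q ^ m) by now apply pow_lt.
  assert (Hl : 0 < Cmod (lam - 1)) by (apply Cmod_gt_0; now apply Cminus_eq_contra).
  (* The first constant settles n = 0, where the divisor is lam - 1 and the diophantine condition
     says nothing. The second absorbs the fixed factor q^m of the denominator (n q)^m. *)
  exists (Rmin (Cmod (lam - 1)) (gamma / INR q ^ m)), m; split.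
  { apply Rmin_case; [exact Hl | now apply Rdiv_lt_0_compat]. }
  intros [|n].
  - simpl; rewrite Rplus_0_l, pow1, Rmult_1_l; apply Rmin_l.
  - eapply Rle_trans; [apply Rmin_r|].
    rewrite e2ipi_pow.
    destruct (e2ipi_dist_nearest_int (IZR p / INR q) (INR (S n) * xi)) as [k Hk].
    fold lam in Hk.
    set (d := Cmod (lam - e2ipi (INR (S n) * xi))) in *.
    set (N := INR (S n)) in *.
    assert (HN : 1 <= N) by (apply (le_INR 1); lia).
    (* The fraction (p - k q) / (N q) is chosen so that N times its distance to [xi] equals |p / q -
       N xi - k|. *)
    specialize (H (p - k * Z.of_nat q)%Z (S n * q)%nat ltac:(nia)).
    rewrite mult_INR, minus_IZR, mult_IZR, <- INR_IZR_INZ in H; fold N in H.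
    replace (IZR p / INR q - N * xi - IZR k)
      with (N * ((IZR p - IZR k * INR q) / (N * INR q) - xi)) in Hk by (field; lra).
    rewrite Rabs_mult, (Rabs_pos_eq N) in Hk by lra.
    set (v := Rabs (_ - xi)) in *.
    assert (Hv : 0 <= v) by apply Rabs_pos.
    assert (Hvd : v <= d) by nra.
    rewrite Rpow_mult_distr in H.
    apply Rle_div_l; [exact Hqm|].
    assert (HNm : 0 < N ^ m) by (apply pow_lt; lra).
    assert (HN1 : N ^ m <= (N + 1) ^ m) by (apply pow_incr; lra).
    eapply Rle_trans; [exact H|].
    apply Rle_trans with (N ^ m * INR q ^ m * d).
    + apply Rmult_le_compat_l; [|exact Hvd]; left; now apply Rmult_lt_0_compat.
    + replace ((N + 1) ^ m * d * INR q ^ m) with ((N + 1) ^ m * INR q ^ m * d) by ring.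
      apply Rmult_le_compat_r; [lra|]; apply Rmult_le_compat_r; lra.
Qed.

(** The powers stay on the unit circle, so the reverse triangle inequality gives a constant bound,
    with m = 0. *)
Lemma poly_separated_off_circle (lam : C) (x : R) :
  Cmod lam <> 1 -> poly_separated lam (e2ipi x).
Proof.
  intros H; exists (Rabs (Cmod lam - 1)), 0%nat; split; [apply Rabs_pos_lt; lra|].
  intros n; rewrite e2ipi_pow; simpl; rewrite Rmult_1_l.
  assert (T1 := Cmod_triangle (lam - e2ipi (INR n * x)) (e2ipi (INR n * x))).
  assert (T2 := Cmod_triangle (e2ipi (INR n * x) - lam) lam).
  rewrite <- Copp_minus_distr, Cmod_opp in T2.
  replace (lam - e2ipi (INR n * x) + e2ipi (INR n * x))%C with lam in T1 by ring.
  replace (- (lam - e2ipi (INR n * x)) + lam)%C with (e2ipi (INR n * x)) in T2 by ring.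
  rewrite Cmod_e2ipi in T1, T2.
  apply Rabs_le; lra.
Qed.

Lemma shifted_comp_rot_series (lam beta : C) (a : nat -> C) (f : C -> C) :
  Cmod beta = 1 ->
  (forall z, in_disc z -> is_Cseries (fun n => a n * z ^ n)%C (f z)) ->
  forall z, in_disc z ->
  is_Cseries (fun n => (lam - beta ^ n) * a n * z ^ n)%C (shifted lam (comp_rot beta) f z).
Proof.
  intros Hb Hf z Hz.
  assert (Hbz : in_disc (beta * z)) by (unfold in_disc; now rewrite Cmod_mult, Hb, Rmult_1_l).
  unfold shifted, comp_rot.
  replace (lam * f z - f (beta * z))%C with (lam * f z + - (1) * f (beta * z))%C by ring.
  refine (is_Cseries_ext _ _ _ _ (is_Cseries_plus _ _ _ _ (is_Cseries_scal lam _ _ (Hf z Hz))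
            (is_Cseries_scal (- (1)) _ _ (Hf _ Hbz)))).
  intros n; simpl; rewrite Cpow_mult_l; ring.
Qed.

Lemma poly_separated_bijective (lam beta : C) :
  Cmod beta = 1 -> poly_separated lam beta ->
  bijective_on_Hol (shifted lam (comp_rot beta)).
Proof.
  intros Hb (c & m & Hc & H).
  assert (Hm : forall n, 0 < (INR n + 1) ^ m)
    by (intros n; apply pow_lt; pose proof (pos_INR n); lra).
  assert (Hd : forall n, 0 < Cmod (lam - beta ^ n)).
  { intros n; specialize (H n); specialize (Hm n).
    pose proof (Cmod_ge_0 (lam - beta ^ n)); nra. }
  assert (Hne : forall n, (lam - beta ^ n)%C <> 0) by (intros n; now apply Cmod_gt_0).
  split.
  - intros f1 f2 H1 H2 E z Hz.
    destruct (taylor_disc f1 H1) as [a1 A1]; destruct (taylor_disc f2 H2) as [a2 A2].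
    apply (is_Cseries_unique (fun n => a1 n * z ^ n)%C); [now apply A1|].
    refine (is_Cseries_ext _ _ _ _ (A2 z Hz)); intros n; f_equal.
    (* Both sides are the n-th coefficient of the common image of [f1] and [f2]; the divisor is then
       cancelled. *)
    assert (K : ((lam - beta ^ n) * a2 n = (lam - beta ^ n) * a1 n)%C).
    { apply (Cseries_coef_unique (fun n => (lam - beta ^ n) * a2 n)%C
               (fun n => (lam - beta ^ n) * a1 n)%C 1 (shifted lam (comp_rot beta) f2)); [lra | |].
      - intros w Hw; now apply shifted_comp_rot_series.
      - intros w Hw; rewrite <- E by exact Hw; now apply shifted_comp_rot_series. }
    replace (a2 n) with (/ (lam - beta ^ n) * ((lam - beta ^ n) * a2 n))%C by (field; apply Hne).
    rewrite K; field; apply Hne.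
  - intros g Hg.
    destruct (taylor_disc g Hg) as [a A].
    set (b := fun n => (a n / (lam - beta ^ n))%C).
    assert (Tb : tame (fun n => Cmod (b n))).
    { apply (tame_le (fun n => (INR n + 1) ^ m * Cmod (a n)) _ (/ c)).
      - intros n; unfold b; rewrite Cmod_div by apply Hne.
        specialize (H n); specialize (Hm n); specialize (Hd n).
        pose proof (Cmod_ge_0 (a n)).
        rewrite !Rabs_pos_eq;
          [| apply Rmult_le_pos; lra | apply Rdiv_le_0_compat; lra].
        apply Rle_div_l; [exact Hd|].
        apply (Rmult_le_reg_l c); [exact Hc|].
        replace (c * (/ c * ((INR n + 1) ^ m * Cmod (a n)) * Cmod (lam - beta ^ n)))
          with ((INR n + 1) ^ m * Cmod (lam - beta ^ n) * Cmod (a n)) by (field; lra).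
        now apply Rmult_le_compat_r.
      - apply tame_mul_poly; exact (Cseries_tame a g A). }
    destruct (tame_series_exists b Tb) as [f Hf].
    exists f; split; [exact (tame_series_holo b f Tb Hf)|].
    intros z Hz.
    apply (is_Cseries_unique (fun n => a n * z ^ n)%C); [|now apply A].
    refine (is_Cseries_ext _ _ _ _ (shifted_comp_rot_series lam beta b f Hb Hf z Hz)).
    intros n; unfold b; field; apply Hne.
Qed.

(** [pow_taylor_bound] with rho = 1 makes the remainder at most n^2 |w - z|^2. *)
Lemma pow_holo (n : nat) : holo_disc (fun z => z ^ n)%C.
Proof.
  intros z Hz; apply C_differentiable_deriv; exists (pow_derivative z n); intros eps Heps.
  unfold in_disc in Hz.
  set (K := INR n ^ 2 + 1).
  assert (HK : 0 < K) by (unfold K; pose proof (pow2_ge_0 (INR n)); lra).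
  exists (Rmin (1 - Cmod z) (eps / K)); split.
  { apply Rmin_case; [lra | now apply Rdiv_lt_0_compat]. }
  intros w Hw.
  assert (h1 := Rlt_le_trans _ _ _ Hw (Rmin_l _ _)).
  assert (h2 := Rlt_le_trans _ _ _ Hw (Rmin_r _ _)); clear Hw.
  assert (Hw : Cmod w <= 1).
  { replace w with (z + (w - z))%C by ring.
    eapply Rle_trans; [apply Cmod_triangle | lra]. }
  assert (B := pow_taylor_bound z w 1 n ltac:(lra) ltac:(lra) Hw).
  rewrite !pow1, !Rmult_1_r in B.
  eapply Rle_trans; [exact B|].
  pose proof (Cmod_ge_0 (w - z)).
  assert (E : eps / K * K = eps) by (field; lra).
  replace (INR n ^ 2 * Cmod (w - z) ^ 2) with (INR n ^ 2 * Cmod (w - z) * Cmod (w - z)) by ring.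
  apply Rmult_le_compat_r; [assumption|].
  apply Rle_trans with (K * Cmod (w - z)); [unfold K; nra | nra].
Qed.

Lemma pow_in_spectrum (beta : C) (n : nat) : in_spectrum (comp_rot beta) (beta ^ n).
Proof.
  intros [inj _].
  assert (H0 : holo_disc (fun _ => RtoC 0)).
  { intros z _; apply C_differentiable_deriv; exists (RtoC 0); apply C_deriv_const. }
  assert (Hh : in_disc (RtoC (1 / 2)))
    by (unfold in_disc; rewrite Cmod_R, Rabs_pos_eq; lra).
  assert (E := inj _ _ (pow_holo n) H0).
  (* Injectivity would identify z^n with 0 on the disc; a nonzero point of the disc refutes this. *)
  apply (Cpow_nz (RtoC (1 / 2)) n); [intros e; apply RtoC_inj in e; lra|].
  apply E; [|exact Hh].
  intros z _; unfold shifted, comp_rot; rewrite Cpow_mult_l; ring.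
Qed.

Theorem theorem4p2 (tau xi : R) (Htau : tau > 2) (Hxi : diophantine tau xi) :
  (forall n : nat, in_spectrum (comp_rot (e2ipi xi)) (Cpow (e2ipi xi) n)) /\
  (forall lam : C, in_spectrum (comp_rot (e2ipi xi)) lam ->
     (exists x : R, irrational x /\ lam = e2ipi x) \/ lam = RtoC 1).
Proof.
  split; [intros n; apply pow_in_spectrum|].
  intros lam Hs.
  destruct (Ceq_dec lam 1) as [e|Hne]; [now right | left].
  destruct (Req_dec (Cmod lam) 1) as [H1|H1].
  - destruct (e2ipi_surj lam H1) as [x ->]; exists x; split; [|reflexivity].
    (* A rational [x] would make [lam] a root of unity other than 1, which is separated from the
       powers of [beta] and hence outside the spectrum. *)
    intros p q Hq ->; apply Hs.
    apply poly_separated_bijective; [apply Cmod_e2ipi|].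
    exact (poly_separated_root_of_unity tau xi p q Hxi Hq Hne).
  - elim Hs; apply poly_separated_bijective; [apply Cmod_e2ipi|].
    now apply poly_separated_off_circle.
Qed.
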